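(* For every integer $T\ge 3$, the toric ideal $I_{A^T}$ is generated by homogeneous binomials of degree at most $6$; equivalently, there is a Markov basis for the toric homogeneous Markov chain model on three states without self-loops and without initial parameters, with time $T$, consisting of moves (binomials) of degree at most $6$.
   Context: For an integer $T\ge 2$, let $\Omega_T$ be the set of words $w=s_1\cdots s_T$ over $\{1,2,3\}$ with $s_l\neq s_{l+1}$ for all $l$. For $w\in\Omega_T$ and $i\ne j$, let $x_{ij}(w)$ be the number of $l\in\{1,\dots,T-1\}$ with $s_ls_{l+1}=ij$. The design matrix $A^T$ is the $6\times 3\cdot2^{T-1}$ matrix with column $[x_{12}(w),x_{13}(w),x_{21}(w),x_{23}(w),x_{31}(w),x_{32}(w)]$ for $w\in\Omega_T$. The toric ideal $I_{A^T}$ is the kernel of the ring homomorphism $\psi:\mathbb C[P(w): w\in\Omega_T]\to\mathbb C[p_{ij}: i,j\in\{1,2,3\}, i\ne j]$, $\psi(P(w))=p_{s_1s_2}p_{s_2s_3}\cdots p_{s_{T-1}s_T}$. A Markov basis is a finite set $\mathcal Z\subset\ker_{\mathbb Z}A^T$ such that any two nonnegative integer vectors $x,y$ with $A^Tx=A^Ty$ are connected by a sequence of moves from $\mathcal Z$ keeping all intermediate vectors nonnegative; Markov bases correspond to binomial generating sets of $I_{A^T}$. *)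

(* Defs.v *)
From HB Require Import structures.
From mathcomp Require Import all_boot all_order all_algebra.
Set Implicit Arguments. Unset Strict Implicit. Unset Printing Implicit Defensive.
Import Order.TTheory GRing.Theory Num.Theory.
Local Open Scope ring_scope.

Definition word (T : nat) := (T.-tuple 'I_3)%type.

Definition noloop (T : nat) (w : word T) : bool :=
  [forall l : 'I_T.-1, nth ord0 w l != nth ord0 w l.+1].

Definition Omega (T : nat) := { w : word T | noloop w }.

Definition trans (T : nat) (w : Omega T) (i j : 'I_3) : nat :=
  (\sum_(l < T.-1) ((nth ord0 (val w) l == i) && (nth ord0 (val w) l.+1 == j)))%N.

Definition vec (T : nat) := {ffun Omega T -> int}.

(* The (i,j) entry (i <> j) of A^T v. *)
Definition Aentry (T : nat) (v : vec T) (i j : 'I_3) : int :=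
  \sum_(w : Omega T) v w * (trans w i j)%:Z.

Definition same_fiber (T : nat) (u v : vec T) : Prop :=
  forall i j : 'I_3, i != j -> Aentry u i j = Aentry v i j.

Definition in_kernel (T : nat) (z : vec T) : Prop :=
  forall i j : 'I_3, i != j -> Aentry z i j = 0.

Definition nonneg (T : nat) (v : vec T) : Prop := forall w, 0 <= v w.

(* Degree of the binomial x^{z+} - x^{z-}: max(|z+|, |z-|). *)
Definition move_degree_le (T : nat) (z : vec T) (d : nat) : Prop :=
  \sum_(w : Omega T) Num.max (z w) 0 <= d%:Z /\
  \sum_(w : Omega T) Num.max (- z w) 0 <= d%:Z.

Inductive connected (T : nat) (Z : seq (vec T)) : vec T -> vec T -> Prop :=
| conn_refl x : connected Z x x
| conn_add x z y : z \in Z -> nonneg (x + z) -> connected Z (x + z) y ->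
    connected Z x y
| conn_sub x z y : z \in Z -> nonneg (x - z) -> connected Z (x - z) y ->
    connected Z x y.

Definition markov_basis (T : nat) (Z : seq (vec T)) : Prop :=
  (forall z, z \in Z -> in_kernel z) /\
  (forall x y : vec T, nonneg x -> nonneg y -> same_fiber x y -> connected Z x y).

(* Main.v *)
Require Import Defs.
From mathcomp Require Import all_boot all_order all_algebra.
From mathcomp Require Import zify ring.
Set Implicit Arguments. Unset Strict Implicit. Unset Printing Implicit Defensive.
Import Order.TTheory GRing.Theory Num.Theory.
Local Open Scope ring_scope.

(** Only the transition counts of a word matter.  Orient the triangle 0 -> 1 ->
    2 -> 0; for each of its three edges let [d] be the number of forward minus
    backward steps, and [m] the number of back-and-forth pairs.  By Euler's
    criterion the words with [n] steps realize exactly the pairs ([d], [m]) in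
    which [d] is flat (its coordinates differ by at most 1), [m] is nonnegative
    and the lengths add up to [n].

    The sum of the coordinates of [d] is its level, and the energy of a multiset
    is the sum of the squared levels.  A move on two words shifting their [d]'s
    towards each other by one of (2,2,2), (1,1,0), (1,0,1), (0,1,1) lowers the
    energy.  If no such move applies, then up to translation by (k,k,k) all the
    [d]'s lie on one face of the lower hull of the squared level, which is a
    simplex or an octahedron.  The affine function supporting that face shows
    that the energy is minimal, hence that every multiset with the same sums and
    no larger energy lives on the same face.  On a simplex this determines the
    multiset of [d]'s.  On an octahedron two such multisets differ by exchanges
    of pairs of opposite vertices.  Once the [d]'s agree, the [m]'s form a table
    with given margins, connected by unit exchanges between two rows.  Every move
    used involves at most two words. *)

(** Makes every absolute value an opaque atom, so that [lia] does not split on signs. The context is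
    cleared, so the relevant facts must be in the goal. *)
Ltac lia_abs := clear;
  repeat match goal with |- context [Num.norm ?x] => move: (Num.norm x) => ? end; lia.

(** * Flat vectors and the faces of the lower hull of the squared level *)

Section FlatVectors.

Definition vec3 := (int * int * int)%type.
Implicit Types (d e : vec3) (U V F : seq vec3).

Definition level d : int := d.1.1 + d.1.2 + d.2.

Definition flat d : bool :=
  [&& `|d.1.1 - d.1.2| <= 1, `|d.1.2 - d.2| <= 1 & `|d.1.1 - d.2| <= 1].

Definition shift (k : int) d : vec3 := (d.1.1 + k, d.1.2 + k, d.2 + k).

(** Moving two levels from $a, b$ to $a+c, b-c$ changes their energy by $-2c(b-a-c)$, so the first
    condition makes it drop. The coordinatewise bounds keep $|d|+|d'|$ from growing on any edge, so
    that the available loads still suffice. *)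
Definition reducible_by e d d' : bool :=
  [&& 0 < level e < level d' - level d,
      [&& e.1.1 <= d'.1.1 - d.1.1, e.1.2 <= d'.1.2 - d.1.2 & e.2 <= d'.2 - d.2],
      flat (d + e) & flat (d' - e)].

(** All these levels are even, so a transfer preserves the parity of a level. *)
Definition transfers : seq vec3 := [:: (2,2,2); (1,1,0); (1,0,1); (0,1,1)].

Definition irreducible_pair d d' : bool :=
  ~~ has (fun e => reducible_by e d d') transfers.

Definition base_points : seq vec3 :=
  [:: (0,0,0); (1,0,0); (0,1,0); (0,0,1); (0,1,1); (1,0,1); (1,1,0)].

Definition slab (k : nat) : seq vec3 :=
  [seq shift (i%:Z - k%:Z) d | i <- iota 0 k.*2.+1, d <- base_points].

Lemma shift0 d : shift 0 d = d.
Proof. by case: d => [[x y] z]; rewrite /shift !addr0. Qed.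

Lemma shift_add j k d : shift j (shift k d) = shift (k + j) d.
Proof. by rewrite /shift /= !addrA. Qed.

Lemma level_shift k d : level (shift k d) = level d + 3 * k.
Proof. by rewrite /level /shift /=; ring. Qed.

Lemma flat_shift k d : flat (shift k d) = flat d.
Proof.
have E (a b : int) : a + k - (b + k) = a - b by ring.
by rewrite /flat /shift /= !E.
Qed.

Lemma reducible_by_shift k e d d' :
  reducible_by e (shift k d) (shift k d') = reducible_by e d d'.
Proof.
have E f : shift k d + f = shift k (d + f).
  by case: d f => [[x y] z] [[a b] c]; rewrite /shift; congr (_, _, _) => /=; ring.
have E' f : shift k d' - f = shift k (d' - f).
  by case: d' f => [[x y] z] [[a b] c]; rewrite /shift; congr (_, _, _) => /=; ring.
rewrite /reducible_by E E' !flat_shift !level_shift; rewrite /shift /=.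
have E1 (a b : int) : a + 3 * k - (b + 3 * k) = a - b by ring.
have E2 (a b : int) : a + k - (b + k) = a - b by ring.
by rewrite E1 !E2.
Qed.

Lemma irreducible_pair_shift k d d' :
  irreducible_pair (shift k d) (shift k d') = irreducible_pair d d'.
Proof.
by rewrite /irreducible_pair; congr (~~ _); apply: eq_has => e; exact: reducible_by_shift.
Qed.

(** Subtracting the smallest coordinate leaves entries 0 or 1, not all equal to 1. *)
Lemma flatP d : flat d -> exists k, exists2 p, p \in base_points & d = shift k p.
Proof.
case: d => [[x y] z] /and3P[/= h1 h2 h3]; exists (Num.min x (Num.min y z)).
have E (a b : int) : a = b \/ a = b + 1 -> exists2 i : int, (i = 0 \/ i = 1) & a = i + b.
  by move=> [->|->]; [exists 0; [left|ring] | exists 1; [right|ring]].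
have [i hi ei] := E x (Num.min x (Num.min y z)) ltac:(lia).
have [j hj ej] := E y (Num.min x (Num.min y z)) ltac:(lia).
have [l hl el] := E z (Num.min x (Num.min y z)) ltac:(lia).
exists (i, j, l); last by congr (_, _, _).
have : ~ (i = 1 /\ j = 1 /\ l = 1) by lia.
by case: hi hj hl => [->|->] [->|->] [->|->] // [].
Qed.

Lemma mem_slab (K : nat) (k : int) p :
  p \in base_points -> - K%:Z <= k <= K%:Z -> shift k p \in slab K.
Proof.
move=> hp hk; apply/allpairsPdep; exists (absz (k + K%:Z)), p; split=> //.
  by rewrite mem_iota; lia.
by congr shift; lia.
Qed.

(* (points, (c, g)): the affine function l d = c + g . d is at most level d ^+ 2
   on the flat points of the right parity, with equality exactly on the points. *)
Definition face := (seq vec3 * (int * vec3))%type.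
Definition affine (f : int * vec3) d : int :=
  f.1 + f.2.1.1 * d.1.1 + f.2.1.2 * d.1.2 + f.2.2 * d.2.

Definition simplices : seq face := [::
  ([:: (0,0,0); (1,1,0); (1,0,1); (0,1,1)], (0, (2,2,2)));
  ([:: (1,1,1); (1,0,0); (0,1,0); (0,0,1)], (-3, (4,4,4)));
  ([:: (1,0,0); (1,1,1); (2,1,2); (2,2,1)], (-11, (12,4,4)));
  ([:: (0,1,0); (1,1,1); (1,2,2); (2,2,1)], (-11, (4,12,4)));
  ([:: (0,0,1); (1,1,1); (1,2,2); (2,1,2)], (-11, (4,4,12)));
  ([:: (0,1,0); (0,0,1); (1,1,1); (1,2,2)], (-7, (0,8,8)));
  ([:: (1,0,0); (0,0,1); (1,1,1); (2,1,2)], (-7, (8,0,8)));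
  ([:: (1,0,0); (0,1,0); (1,1,1); (2,2,1)], (-7, (8,8,0)));
  ([:: (1,0,0); (2,1,2); (2,2,1); (3,2,2)], (-23, (24,0,0)));
  ([:: (0,1,0); (1,2,2); (2,2,1); (2,3,2)], (-23, (0,24,0)));
  ([:: (0,0,1); (1,2,2); (2,1,2); (2,2,3)], (-23, (0,0,24)));
  ([:: (0,1,1); (1,1,2); (1,2,1); (2,3,3)], (-32, (-6,18,18)));
  ([:: (1,0,1); (1,1,2); (2,1,1); (3,2,3)], (-32, (18,-6,18)));
  ([:: (1,1,0); (1,2,1); (2,1,1); (3,3,2)], (-32, (18,18,-6)))].

(** The points $(1,1,1)\pm$ unit vector; the centre has the opposite parity of level. The three
    pairs of opposite vertices have equal sums, so sums alone do not determine the
    multiplicities. *)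
Definition octahedron : face :=
  ([:: (0,1,1); (1,0,1); (1,1,0); (2,1,1); (1,2,1); (1,1,2)], (-8, (6,6,6))).

(** The level of a word has the parity of its number of steps, so a fiber meets a single parity
    class. *)
Definition same_parity d d' := (2 %| level d - level d')%Z.

Definition excess (f : int * vec3) d : int := level d ^+ 2 - affine f d.

(* The last two bounds force the excess to be positive outside the slab. *)
Definition face_ok (f : face) :=
  [&& all (fun p => (excess f.2 p == 0) && same_parity p (head 0 f.1)) f.1,
      all (fun d => same_parity d (head 0 f.1) ==>
        (0 < excess f.2 d) || (d \in f.1) && (excess f.2 d == 0)) (slab 9),
      `|level f.2.2| <= 30 & all (fun p => `|affine f.2 p| <= 100) base_points].

Definition base_stack : seq vec3 := [seq shift k%:Z p | k <- iota 0 3, p <- base_points].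

Definition candidates d0 :=
  [seq d <- base_stack | [&& level d0 <= level d, same_parity d d0 & irreducible_pair d0 d]].

(* A leaf names a face that contains every irreducible set reaching it; a node
   branches on whether its point belongs to the set. *)
Inductive dtree := Leaf of nat | Node of vec3 & dtree & dtree.

Definition nth_face k := nth octahedron simplices k.

Fixpoint covers (W : seq vec3) (t : dtree) : bool :=
  match t with
  | Leaf k => all (mem (nth_face k).1) W
  | Node p t1 t2 =>
      covers [seq d <- W | irreducible_pair p d && irreducible_pair d p] t1
      && covers [seq d <- W | d != p] t2
  end.

(* In the order of [base_points].  The index 14 is out of range and therefore
   denotes the default, the octahedron. *)
Definition dtrees : seq dtree :=
  [:: Leaf 0;
      Node (3,2,2) (Leaf 8) (Node (0,1,0)
        (Node (0,0,1) (Leaf 1) (Leaf 7)) (Node (0,0,1) (Leaf 6) (Leaf 2)));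
      Node (2,3,2) (Leaf 9) (Node (1,0,0)
        (Node (0,0,1) (Leaf 1) (Leaf 7)) (Node (0,0,1) (Leaf 5) (Leaf 3)));
      Node (2,2,3) (Leaf 10) (Node (1,0,0)
        (Node (0,1,0) (Leaf 1) (Leaf 6)) (Node (0,1,0) (Leaf 5) (Leaf 4)));
      Node (2,3,3) (Leaf 11) (Leaf 14);
      Node (3,2,3) (Leaf 12) (Leaf 14);
      Node (3,3,2) (Leaf 13) (Leaf 14)].

Lemma mem_nth_default (T : eqType) (x0 : T) s k : nth x0 s k \in x0 :: s.
Proof.
have [hk|hk] := ltnP k (size s); first by rewrite inE mem_nth ?orbT.
by rewrite nth_default // mem_head.
Qed.

Lemma faces_ok : all face_ok (octahedron :: simplices).
Proof. by vm_compute. Qed.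

Lemma nth_face_ok k : face_ok (nth_face k).
Proof. by apply: (allP faces_ok); exact: mem_nth_default. Qed.

Lemma dtreesP p : p \in base_points -> exists t, covers (candidates p) t.
Proof.
have h: all (fun i => covers (candidates (nth 0 base_points i)) (nth (Leaf 0) dtrees i))
  (iota 0 (size base_points)) by vm_compute.
case/(nthP 0)=> i hi <-; exists (nth (Leaf 0) dtrees i).
by apply: (allP h); rewrite mem_iota.
Qed.

Lemma base_points_bounds d : d \in base_points ->
  [/\ 0 <= d.1.1 <= 1, 0 <= d.1.2 <= 1, 0 <= d.2 <= 1 & level d <= 2].
Proof.
have h: all (fun d => [&& 0 <= d.1.1 <= 1, 0 <= d.1.2 <= 1, 0 <= d.2 <= 1 & level d <= 2]) base_points by [].
by move/(allP h)/and4P.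
Qed.

Lemma affine_shift f k d : affine f (shift k d) = affine f d + level f.2 * k.
Proof. by rewrite /affine /level /shift /=; ring. Qed.

(** Inside the slab this is the computation behind [face_ok]. Far along $(1,1,1)$ the squared level
    grows quadratically and overtakes the affine function. *)
Lemma face_excess k d : flat d -> same_parity d (head 0 (nth_face k).1) ->
  (0 < excess (nth_face k).2 d) ||
  (d \in (nth_face k).1) && (excess (nth_face k).2 d == 0).
Proof.
move=> hd; have /and4P[_ hs hg hw] := nth_face_ok k.
have [j [p hp ->]] := flatP hd.
have [hj|hj] := boolP (- 9 <= j <= 9).
  exact: (implyP (allP hs _ (mem_slab hp hj))).
move=> _; apply/orP; left.
rewrite /excess affine_shift level_shift.
have := allP hw p hp; move: hg hj; have [] := base_points_bounds hp.
rewrite /level; move: (affine _ _) => a; case: (nth_face k) => [? [? [[x y] z]]] /=.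
case: p {hp} => [[p q] r] /= h1 h2 h3 h4 hg hj ha.
have [l hl e] : exists2 l, 0 <= l <= 2 & l = p + q + r by exists (p + q + r) => //; lia.
have [g hg' e'] : exists2 g, -30 <= g <= 30 & g = x + y + z by exists (x + y + z) => //; lia.
rewrite -e -e' {h1 h2 h3 h4 hg e e'}.
(* In both cases $9j^2 + 6lj - gj \ge 48|j|$, which exceeds the bound 100 on the value at the base
   point. *)
have [h|h] : 10 <= j \/ j <= -10 by lia.
- have : g * j <= 30 * j by nia.
  have : (9 * 10 + 6 * l) * j <= 9 * (j * j) + 6 * l * j by nia.
  by rewrite expr2; nia.
have : g * j <= - 30 * j by nia.
have : (-90 + 6 * l) * j <= 9 * (j * j) + 6 * l * j by nia.
by rewrite expr2; nia.
Qed.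

(** A translate by a negative amount would lie below [p], and a translate by 3 or more lies so far
    above it that the transfer (2,2,2) applies. *)
Lemma candidatesP p d : p \in base_points -> flat d -> level p <= level d ->
  same_parity d p -> irreducible_pair p d -> d \in candidates p.
Proof.
move=> hp hd hl hpd hirr; rewrite mem_filter hl hpd hirr /=.
have [k [q hq ed]] := flatP hd.
have [p1 p2 p3 p4] := base_points_bounds hp; have [q1 q2 q3 q4] := base_points_bounds hq.
have [hk|hk] := boolP (0 <= k <= 2).
  apply/allpairsPdep; exists (absz k), q; split => //; first by rewrite mem_iota; lia.
  by rewrite ed; congr shift; lia.
have lk : level d = level q + 3 * k by rewrite ed level_shift.
have k3 : 3 <= k by move: hl; rewrite lk /level in p4 q4 *; lia.
case/negP: hirr; apply/hasP; exists ((2,2,2) : vec3) => //.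
have e1 : p + (2,2,2) = shift 2 p by case: (p) => [[]].
have e2 : d - (2,2,2) = shift (-2) d by case: (d) => [[]].
have fp : flat p by have h : all flat base_points by []; exact: (allP h).
rewrite /reducible_by e1 e2 !flat_shift hd fp !andbT lk ed /=.
have -> : level (2,2,2) = 6 by [].
apply/andP; split; first by rewrite /level in p4 q4 *; lia.
by apply/and3P; split; rewrite /=; lia.
Qed.

Definition irreducible U := {in U &, forall d d', irreducible_pair d d'}.

Lemma covers_face t W U : covers W t -> {subset U <= W} -> irreducible U ->
  exists k, {subset U <= (nth_face k).1}.
Proof.
elim: t W => [k|p t1 IH1 t2 IH2] W /=.
  by move=> /allP h hU _; exists k => d /hU /h.
case/andP=> h1 h2 hU irrU.
have [hp|hp] := boolP (p \in U).
  by apply: IH1 h1 _ _ => // d hd; rewrite mem_filter !irrU // hU.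
apply: IH2 h2 _ _ => // d hd; rewrite mem_filter hU // andbT.
by apply: contraNneq hp => <-.
Qed.

End FlatVectors.

(** * Coordinate sums, affine functions and energy of multisets of vectors *)

Section Sums.

Implicit Types (d e : vec3) (U V F : seq vec3).

Definition energy U : int := \sum_(d <- U) level d ^+ 2.

Definition same_sum U V :=
  [/\ size U = size V, \sum_(d <- U) d.1.1 = \sum_(d <- V) d.1.1,
      \sum_(d <- U) d.1.2 = \sum_(d <- V) d.1.2 &
      \sum_(d <- U) d.2 = \sum_(d <- V) d.2].

Lemma sum_affine f U : \sum_(d <- U) affine f d =
  f.1 * (size U)%:Z + f.2.1.1 * (\sum_(d <- U) d.1.1) +
  f.2.1.2 * (\sum_(d <- U) d.1.2) + f.2.2 * (\sum_(d <- U) d.2).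
Proof.
elim: U => [|d U IH]; first by rewrite !big_nil /=; ring.
by rewrite !big_cons IH /affine /= -[(size U).+1]addn1 PoszD; ring.
Qed.

Lemma same_sum_affine f U V : same_sum U V ->
  \sum_(d <- U) affine f d = \sum_(d <- V) affine f d.
Proof. by case=> e0 e1 e2 e3; rewrite !sum_affine e0 e1 e2 e3. Qed.

Lemma same_sum_shift k U V :
  same_sum U V -> same_sum (map (shift k) U) (map (shift k) V).
Proof.
move=> h; have [e _ _ _] := h.
have A c x y z W : \sum_(d <- W) affine (c, (x, y, z)) d =
    \sum_(d <- W) (c + x * d.1.1 + y * d.1.2 + z * d.2) by [].
split; first by rewrite !size_map.
- have := same_sum_affine (k, (1,0,0)) h; rewrite !A !big_map.
  by congr (_ = _); apply: eq_bigr => d _ /=; ring.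
- have := same_sum_affine (k, (0,1,0)) h; rewrite !A !big_map.
  by congr (_ = _); apply: eq_bigr => d _ /=; ring.
have := same_sum_affine (k, (0,0,1)) h; rewrite !A !big_map.
by congr (_ = _); apply: eq_bigr => d _ /=; ring.
Qed.

(** A translation changes the squared level by an affine function, so it does not affect the
    comparison of energies of multisets with the same sums. *)
Lemma energy_shift k U : energy (map (shift k) U) =
  energy U + \sum_(d <- U) affine (9 * k ^+ 2, (6 * k, 6 * k, 6 * k)) d.
Proof.
rewrite /energy big_map -big_split; apply: eq_bigr => d _ /=.
by rewrite level_shift /affine /level /=; ring.
Qed.

Lemma sum_by_count (f : vec3 -> int) U F : uniq F -> {subset U <= F} ->
  \sum_(d <- U) f d = \sum_(p <- F) f p * (count_mem p U)%:Z.
Proof.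
move=> uF; elim: U => [|d U IH] hU.
  by rewrite big_nil big1 // => p _; rewrite mulr0.
rewrite big_cons IH; last by move=> e he; apply: hU; rewrite inE he orbT.
have dF : d \in F by apply: hU; rewrite mem_head.
rewrite [RHS](eq_bigr (fun p => f p * (d == p)%:Z + f p * (count_mem p U)%:Z)).
  rewrite big_split /=; congr (_ + _).
  rewrite (bigD1_seq d) //= eqxx mulr1 big1 ?addr0 // => p hp.
  by rewrite eq_sym (negPf hp) mulr0.
by move=> p _; rewrite -mulrDr -PoszD.
Qed.

Lemma perm_eq_count U V F : {subset U <= F} -> {subset V <= F} ->
  {in F, forall p, (count_mem p U)%:Z = (count_mem p V)%:Z :> int} -> perm_eq U V.
Proof.
move=> hU hV h; apply/allP => d; rewrite mem_cat => hd /=.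
have dF : d \in F by case/orP: hd => [/hU|/hV].
by apply/eqP; case: (h d dF).
Qed.

(** The size and the three coordinate sums form a linear system for the four multiplicities,
    invertible because the vertices are affinely independent. *)
Lemma simplex_perm k U V : (k < size simplices)%N ->
  {subset U <= (nth_face k).1} -> {subset V <= (nth_face k).1} ->
  same_sum U V -> perm_eq U V.
Proof.
move=> hk hU hV hs; apply: (perm_eq_count hU hV).
have uF : uniq (nth_face k).1.
  have h : all (fun f : face => uniq f.1) simplices by vm_compute.
  by rewrite /nth_face; apply: (allP h); rewrite mem_nth.
have E f : \sum_(p <- (nth_face k).1) affine f p * (count_mem p U)%:Z
   = \sum_(p <- (nth_face k).1) affine f p * (count_mem p V)%:Z.
  by rewrite -(sum_by_count (affine f) uF hU) -(sum_by_count (affine f) uF hV) (same_sum_affine f hs).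
have := E (0, (0, 0, 1)); have := E (0, (0, 1, 0)); have := E (0, (1, 0, 0)).
have := E (1, (0, 0, 0)).
have in4 (P : vec3 -> Prop) a b c e : P a -> P b -> P c -> P e ->
   {in [:: a; b; c; e], forall p, P p}.
  by move=> ? ? ? ? p; rewrite !inE => /or4P[] /eqP->.
have -> : nth_face k = nth octahedron simplices k by [].
move: k hk {hU hV uF E}.
do 14! [case; first by move=> _; rewrite /simplices /= !big_cons !big_nil
   /affine /= => e1 e2 e3 e4; apply: in4; lia].
by [].
Qed.

End Sums.

(** * Irreducible multisets have minimal energy *)

Section Irreducible.

Implicit Types (d e : vec3) (U V F : seq vec3).

Lemma exists_min_level d0 U : exists2 d, d \in d0 :: U &
  {in d0 :: U, forall e, level d <= level e}.
Proof.
elim: U d0 => [|d1 U IH] d0.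
  by exists d0; rewrite ?mem_head // => e; rewrite inE => /eqP->.
have [d hd hmin] := IH d1.
have [h|h] := leP (level d0) (level d).
  exists d0; rewrite ?mem_head // => e; rewrite inE => /orP[/eqP->//|/hmin].
  exact: le_trans.
exists d; first by rewrite inE hd orbT.
by move=> e; rewrite inE => /orP[/eqP->|/hmin //]; exact: ltW.
Qed.

Lemma inj_shift k : injective (shift k).
Proof. by apply: (can_inj (g := shift (- k))) => d; rewrite shift_add subrr shift0. Qed.

(* The excess of the affine function supporting the face that contains [U] sums
   to zero over [U] and to at most zero over [V]. *)
Lemma subset_face k U V :
  {subset U <= (nth_face k).1} -> {in V, forall d, flat d} ->
  {in V, forall d, same_parity d (head 0 (nth_face k).1)} ->
  same_sum U V -> energy V <= energy U -> {subset V <= (nth_face k).1}.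
Proof.
move=> hU fV pV hs hE.
have exc W : \sum_(d <- W) excess (nth_face k).2 d =
    energy W - \sum_(d <- W) affine (nth_face k).2 d.
  by rewrite -sumrB.
have U0 : \sum_(d <- U) excess (nth_face k).2 d = 0.
  rewrite big_seq big1 // => d /hU hd; have /and4P[/allP h _ _ _] := nth_face_ok k.
  by have /andP[/eqP] := h d hd.
have V0 : \sum_(d <- V) excess (nth_face k).2 d <= 0.
  by move: U0 hE; rewrite !exc (same_sum_affine _ hs); lia.
have hV d : d \in V -> (0 < excess (nth_face k).2 d) ||
  (d \in (nth_face k).1) && (excess (nth_face k).2 d == 0).
  by move=> hd; apply: face_excess; [exact: fV | exact: pV].
have pos d : d \in V -> 0 <= excess (nth_face k).2 d.
  by move=> /hV /orP[/ltW|/andP[_ /eqP->]].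
move=> d hd; have := hV d hd; case/orP=> [hpos|/andP[]//].
have : \sum_(e <- V) excess (nth_face k).2 e = 0.
  by apply/eqP; rewrite eq_le V0 big_seq sumr_ge0.
move: V0; rewrite (big_rem d) //= => V0 _.
suff : 0 < excess (nth_face k).2 d + \sum_(e <- rem d V) excess (nth_face k).2 e.
  by rewrite ltNge V0.
apply: ltr_wpDr hpos; rewrite big_seq sumr_ge0 // => e he; apply: pos.
exact: mem_rem he.
Qed.

(** A translation turns a lowest point of [U] into a base point; the decision tree then places [U]
    on a face, and the energy bound places [V] on the same one. For the octahedron it suffices to
    record levels: together with flatness they identify its vertices. *)
Lemma irreducible_perm U V :
  {in U ++ V, forall d, flat d} -> {in U ++ V &, forall d e, same_parity d e} ->
  irreducible U -> same_sum U V -> energy V <= energy U ->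
  perm_eq U V \/
  exists k, {in U ++ V, forall d, level d = 3 * k - 1 \/ level d = 3 * k + 1}.
Proof.
case: U => [|u U] fl par irr hs hE.
  by left; case: hs => /esym/size0nil->.
have [d0 hd0 hmin] := exists_min_level u U; move: (u :: U) => {u}U in hd0 hmin fl par irr hs hE *.
have hd0' : d0 \in U ++ V by rewrite mem_cat hd0.
have [k [p hp e0]] := flatP (fl _ hd0').
have p0 : shift (- k) d0 = p by rewrite e0 shift_add subrr shift0.
set U' := map (shift (- k)) U; set V' := map (shift (- k)) V.
have sub d : d \in U' ++ V' -> exists2 e, e \in U ++ V & d = shift (- k) e.
  by rewrite -map_cat => /mapP.
have subU d : d \in U' -> exists2 e, e \in U & d = shift (- k) e by move/mapP.
have par' d : d \in U' ++ V' -> same_parity d p.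
  case/sub=> e he ->; rewrite -p0 /same_parity !level_shift.
  rewrite (_ : level e + 3 * - k - (level d0 + 3 * - k) = level e - level d0); last by ring.
  exact: par.
have fl' d : d \in U' ++ V' -> flat d by case/sub=> e he ->; rewrite flat_shift fl.
have irr' : irreducible U'.
  by move=> _ _ /subU[d hd ->] /subU[e he ->]; rewrite irreducible_pair_shift irr.
have hs' := same_sum_shift (- k) hs.
have hE' : energy V' <= energy U'.
  by rewrite /U' /V' !energy_shift (same_sum_affine _ hs) lerD2r.
have cand : {subset U' <= candidates p}.
  move=> d hd; have hd2 : d \in U' ++ V' by rewrite mem_cat hd.
  apply: candidatesP; rewrite ?fl' ?par' //.
    by have [e he ->] := subU _ hd; rewrite -p0 !level_shift lerD2r hmin.
  by apply: irr' => //; rewrite -p0; apply: map_f.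
have [t ht] := dtreesP hp.
have [j hj] := covers_face ht cand irr'.
have pU : p \in (nth_face j).1 by apply: hj; rewrite -p0; apply: map_f.
have hpar : same_parity p (head 0 (nth_face j).1).
  by have /and4P[/allP h _ _ _] := nth_face_ok j; case/andP: (h p pU).
have hjV : {subset V' <= (nth_face j).1}.
  apply: subset_face hj _ _ hs' hE' => d hd.
    by apply: fl'; rewrite mem_cat hd orbT.
  have := par' d; rewrite mem_cat hd orbT => /(_ isT).
  by move: hpar; rewrite /same_parity => h1 h2; rewrite -(subrK (level p) (level d)) -addrA rpredD.
have [hjs|hjs] := ltnP j (size simplices).
  left; have := simplex_perm hjs hj hjV hs'.
  by rewrite /U' /V' => h; apply: (perm_map_inj (@inj_shift (- k))).
(* The octahedron is centred at (1,1,1), hence at $(k+1,k+1,k+1)$ before the translation. *)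
right; exists (k + 1) => d hd.
have : shift (- k) d \in U' ++ V' by rewrite -map_cat map_f.
have : {subset U' ++ V' <= octahedron.1}.
  have e : nth_face j = octahedron by rewrite /nth_face nth_default.
  by rewrite e in hj hjV; move=> ?; rewrite mem_cat => /orP[/hj|/hjV].
move=> h /h hoct.
have hall : all (fun d => (level d == 2) || (level d == 4)) octahedron.1 by [].
have := allP hall _ hoct; rewrite level_shift => /orP[]/eqP h2; [left|right]; move: h2; clear; lia.
Qed.

End Irreducible.

(** * Profiles and moves on at most six profiles *)

Section Profiles.

Implicit Types (d e : vec3) (U V F : seq vec3).

Lemma same_sum_sym U V : same_sum U V -> same_sum V U.
Proof. by case. Qed.

Lemma same_sum_trans V U F : same_sum U V -> same_sum V F -> same_sum U F.
Proof.
by case=> a b c d [a' b' c' d']; split; [rewrite a|rewrite b|rewrite c|rewrite d].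
Qed.

Lemma perm_same_sum U V : perm_eq U V -> same_sum U V.
Proof. by move=> h; split; rewrite ?(perm_size h) // (perm_big _ h). Qed.

Lemma same_sum_cat U V F G :
  same_sum U V -> same_sum F G -> same_sum (U ++ F) (V ++ G).
Proof.
by case=> a b c d [a' b' c' d']; split; rewrite ?size_cat ?big_cat /=; congr (_ + _).
Qed.

Lemma same_sum_catIr F U V : same_sum (U ++ F) (V ++ F) -> same_sum U V.
Proof.
rewrite /same_sum !size_cat !big_cat /= => -[/addIn h1 /addIr h2 /addIr h3 /addIr h4].
by split.
Qed.

(* The pairs ([d], [m]) above; the load is the number of steps along each edge,
   in either direction. *)
Definition profile := (vec3 * vec3)%type.
Implicit Types (r x y w : profile) (X Y : seq profile).

Definition load r : vec3 :=
  (`|r.1.1.1| + 2 * r.2.1.1, `|r.1.1.2| + 2 * r.2.1.2, `|r.1.2| + 2 * r.2.2).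

Definition good (n : nat) r : bool :=
  [&& flat r.1, 0 <= r.2.1.1, 0 <= r.2.1.2, 0 <= r.2.2 & level (load r) == n%:Z].

(** On each edge, direction and load are the difference and the sum of the forward and backward
    counts, so these totals encode all six transition counts. *)
Definition same_total X Y :=
  same_sum (map fst X) (map fst Y) /\ same_sum (map load X) (map load Y).

Lemma same_total_sym X Y : same_total X Y -> same_total Y X.
Proof. by case=> h1 h2; split; apply: same_sum_sym. Qed.

Lemma same_total_trans Y X Z : same_total X Y -> same_total Y Z -> same_total X Z.
Proof.
by move=> [a b] [c d]; split; [exact: same_sum_trans a c|exact: same_sum_trans b d].
Qed.

Lemma perm_same_total X Y : perm_eq X Y -> same_total X Y.
Proof. by move=> h; split; apply: perm_same_sum; apply: perm_map. Qed.

Lemma same_total_catr Z X Y : same_total X Y -> same_total (X ++ Z) (Y ++ Z).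
Proof. by case=> h1 h2; split; rewrite !map_cat; apply: same_sum_cat. Qed.

Lemma same_total_catIr Z X Y : same_total (X ++ Z) (Y ++ Z) -> same_total X Y.
Proof. by rewrite /same_total !map_cat => -[h1 h2]; split; apply: same_sum_catIr; eassumption. Qed.

Inductive linked (n : nat) : seq profile -> seq profile -> Prop :=
| linked_perm X Y : perm_eq X Y -> linked n X Y
| linked_step u v X : (size u <= 6)%N -> all (good n) u -> all (good n) v ->
    same_total u v -> linked n (u ++ X) (v ++ X)
| linked_trans Y X Z : linked n X Y -> linked n Y Z -> linked n X Z.

Lemma linked_sym n X Y : linked n X Y -> linked n Y X.
Proof.
elim=> [{}X {}Y h|u v Z su gu gv h|{}Y {}X Z _ h1 _ h2].
- by apply: linked_perm; rewrite perm_sym.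
- apply: linked_step => //; last exact: same_total_sym.
  by have [[e _ _ _] _] := h; rewrite !size_map in e; rewrite -e.
exact: linked_trans h2 h1.
Qed.

Lemma linked_good n X Y : linked n X Y -> all (good n) X -> all (good n) Y.
Proof.
elim=> [{}X {}Y h|u v Z su gu gv h|{}Y {}X Z _ h1 _ h2].
- by rewrite (perm_all _ h).
- by rewrite !all_cat gv => /andP[].
by move=> /h1.
Qed.

Lemma linked_total n X Y : linked n X Y -> same_total X Y.
Proof.
elim=> [{}X {}Y h|u v Z su gu gv h|{}Y {}X Z _ h1 _ h2].
- exact: perm_same_total.
- exact: same_total_catr.
exact: same_total_trans h1 h2.
Qed.

Lemma linked_cons n w X Y : linked n X Y -> linked n (w :: X) (w :: Y).
Proof.
elim=> [{}X {}Y h|u v Z su gu gv h|{}Y {}X Z _ h1 _ h2].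
- by apply: linked_perm; rewrite perm_cons.
- have P t : perm_eq (w :: t ++ Z) (t ++ w :: Z) by rewrite perm_sym -cat1s perm_catCA.
  apply: linked_trans (linked_perm _ (P u)) _.
  apply: (@linked_trans _ (v ++ w :: Z)); first exact: linked_step.
  by apply: linked_perm; rewrite perm_sym P.
exact: linked_trans h1 h2.
Qed.

Lemma linked_pair n x x' y y' X : all (good n) [:: x; x'; y; y'] ->
  same_total [:: x; x'] [:: y; y'] -> linked n [:: x, x' & X] [:: y, y' & X].
Proof.
case/and5P=> gx gx' gy gy' _ h.
by apply: (@linked_step n [:: x; x'] [:: y; y']) => //=; rewrite ?gx ?gx' ?gy ?gy'.
Qed.

Lemma same_totalE x x' y y' :
  [/\ x.1.1.1 + x'.1.1.1 = y.1.1.1 + y'.1.1.1,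
      x.1.1.2 + x'.1.1.2 = y.1.1.2 + y'.1.1.2 &
      x.1.2 + x'.1.2 = y.1.2 + y'.1.2] ->
  [/\ (load x).1.1 + (load x').1.1 = (load y).1.1 + (load y').1.1,
      (load x).1.2 + (load x').1.2 = (load y).1.2 + (load y').1.2 &
      (load x).2 + (load x').2 = (load y).2 + (load y').2] ->
  same_total [:: x; x'] [:: y; y'].
Proof.
by move=> [a b c] [e f g]; split; split; rewrite //= !big_cons !big_nil !addr0.
Qed.

Lemma abs_parity (a b c e : int) : a + b = c + e ->
  exists t, `|a| + `|b| = `|c| + `|e| + 2 * t.
Proof.
by move=> h; exists ((`|a| + `|b| - `|c| - `|e|) %/ 2)%Z; lia.
Qed.

(** Once [d] and [d'] are paid for, the joint load left on each edge is even, hence consists of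
    back-and-forth pairs. These are dealt out so that both new profiles have length [n]. *)
Lemma refill n x x' d d' :
  good n x -> good n x' -> flat d -> flat d' ->
  [/\ x.1.1.1 + x'.1.1.1 = d.1.1 + d'.1.1, x.1.1.2 + x'.1.1.2 = d.1.2 + d'.1.2 &
      x.1.2 + x'.1.2 = d.2 + d'.2] ->
  [/\ `|d.1.1| + `|d'.1.1| <= (load x).1.1 + (load x').1.1,
      `|d.1.2| + `|d'.1.2| <= (load x).1.2 + (load x').1.2 &
      `|d.2| + `|d'.2| <= (load x).2 + (load x').2] ->
  same_parity d x.1 -> `|level d| <= n%:Z -> `|level d'| <= n%:Z ->
  exists y y', [/\ y.1 = d, y'.1 = d', good n y, good n y' &
    same_total [:: x; x'] [:: y; y']].
Proof.
case: x x' d d' => [[[a1 a2] a3] [[m1 m2] m3]] [[[b1 b2] b3] [[k1 k2] k3]] [[d1 d2] d3] [[e1 e2] e3].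
move=> /and5P[/= fa m1p m2p m3p /eqP /= na] /and5P[/= fb k1p k2p k3p /eqP /= nb] fd fe [s1 s2 s3] [l1 l2 l3].
rewrite /same_parity /level /load /= in na nb l1 l2 l3 * => par nd ne.
have [t1 T1] := abs_parity s1; have [t2 T2] := abs_parity s2.
have [t3 T3] := abs_parity s3.
(* Integer coordinates differing by at most 1 never have opposite signs. *)
have Ld : `|d1| + `|d2| + `|d3| = `|d1 + d2 + d3|.
  by move: fd; rewrite /flat /=; clear; lia.
have Le : `|e1| + `|e2| + `|e3| = `|e1 + e2 + e3|.
  by move: fe; rewrite /flat /=; clear; lia.
(* [q] is the number of back-and-forth pairs that [d] needs to reach length [n]. *)
have [q Q] : exists q, `|d1 + d2 + d3| + 2 * q = n%:Z.
  have : exists q, `|a1| + `|a2| + `|a3| = (a1 + a2 + a3) + 2 * q.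
    by exists ((`|a1| + `|a2| + `|a3| - (a1 + a2 + a3)) %/ 2)%Z; clear; lia.
  move=> [q hq]; exists ((n%:Z - `|d1 + d2 + d3|) %/ 2)%Z; move: na hq par; clear; lia.
have q0 : 0 <= q by move: Q nd; lia_abs.
(* The pairs available on each edge: those of [x] and [x'], corrected by the change in absolute
   values. *)
pose u1 := t1 + m1 + k1; pose u2 := t2 + m2 + k2; pose u3 := t3 + m3 + k3.
have P1 : 0 <= u1 by rewrite /u1; move: T1 l1; lia_abs.
have P2 : 0 <= u2 by rewrite /u2; move: T2 l2; lia_abs.
have P3 : 0 <= u3 by rewrite /u3; move: T3 l3; lia_abs.
have R : q <= u1 + u2 + u3.
  by rewrite /u1 /u2 /u3; move: na nb T1 T2 T3 Ld Le Q ne; lia_abs.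
have [v [v1 [v2 [v3 [v4 v5]]]]] : exists v : vec3,
   0 <= v.1.1 <= u1 /\ 0 <= v.1.2 <= u2 /\ 0 <= v.2 <= u3 /\ v.1.1 + v.1.2 + v.2 = q /\ True.
  (* Greedy choice of [q] pairs, edge after edge; the second profile receives the rest. *)
  exists (Num.min u1 q, Num.min u2 (q - Num.min u1 q), q - Num.min u1 q - Num.min u2 (q - Num.min u1 q)).
  move: P1 P2 P3 R q0; move: u1 u2 u3 => ? ? ? /=; clear.
  by repeat split; lia.
case: v v1 v2 v3 v4 {v5} => [[v1 v2] v3] /= V1 V2 V3 V.
exists ((d1, d2, d3), (v1, v2, v3)), ((e1, e2, e3), (u1 - v1, u2 - v2, u3 - v3)).
split=> //.
- rewrite /good fd /load /level /=; apply/and4P.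
  by split; move: V1 V2 V3 V Q Ld; lia_abs.
- rewrite /good fe /load /level /=; rewrite /u1 /u2 /u3 in V1 V2 V3 *; apply/and4P.
  by split; move: V1 V2 V3 V Q Ld Le na nb T1 T2 T3; lia_abs.
apply: same_totalE; rewrite /= /u1 /u2 /u3; split=> //;
  by [move: T1; lia_abs|move: T2; lia_abs|move: T3; lia_abs].
Qed.

End Profiles.

(** * Energy-lowering transfers and unit exchanges of back-and-forth pairs *)

Section Reduction.

Implicit Types (d e : vec3) (U V F : seq vec3) (r x y w : profile) (X Y : seq profile).

Lemma perm_rem2 X x x' : x \in X -> x' \in X -> x != x' ->
  perm_eq X [:: x, x' & rem x' (rem x X)].
Proof.
move=> hx hx' hn; apply: perm_trans (perm_to_rem hx) _; rewrite perm_cons.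
apply: perm_to_rem; move: hx'; rewrite (perm_mem (perm_to_rem hx)) inE.
by rewrite eq_sym (negPf hn).
Qed.

Lemma good_flat n x : good n x -> flat x.1.
Proof. by case/and5P. Qed.

Lemma good_level n x : good n x -> `|level x.1| <= n%:Z.
Proof.
case: x => [[[a b] c] [[p q] r]] /and5P[_ /= h1 h2 h3 /eqP].
by rewrite /level /load /=; move: h1 h2 h3; clear; lia.
Qed.

Lemma good_parity n x : good n x -> (2 %| n%:Z - level x.1)%Z.
Proof.
case: x => [[[a b] c] [[p q] r]] /and5P[_ /= h1 h2 h3 /eqP].
rewrite /level /load /=.
have abs z : exists t : int, `|z| = z + 2 * t.
  by have [h|h] := leP 0 z; [exists 0|exists (- z)]; lia.
have [t ->] := abs a; have [u ->] := abs b; have [v ->] := abs c; clear.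
by lia.
Qed.

(** A failure of irreducibility names two profiles and a transfer, which [refill] realizes. The new
    levels lie between the old ones, so they stay within the length bound. *)
Lemma energy_reduce n X : all (good n) X -> irreducible (map fst X) \/
  exists2 X', linked n X X' & energy (map fst X') < energy (map fst X).
Proof.
move=> gX; set U := map fst X.
have [h|] := boolP (all (fun d => all (irreducible_pair d) U) U).
  by left=> d d' hd; apply: (allP (allP h d hd)).
move=> /allPn[_ /mapP[x hx ->]] /allPn[_ /mapP[x' hx' ->]].
rewrite negbK => /hasP[e he hr]; right.
have /and4P[/andP[lp lt] /and3P[l1 l2 l3] f1 f2] := hr.
have xx' : x != x' by apply: contraTneq lt => ->; rewrite subrr -leNgt ltW.
have [e1 e2 e3 e4] : [/\ 0 <= e.1.1, 0 <= e.1.2, 0 <= e.2 & (2 %| level e)%Z].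
  have h : all (fun e => [&& 0 <= e.1.1, 0 <= e.1.2, 0 <= e.2 & (2 %| level e)%Z]) transfers by [].
  by apply/and4P; exact: (allP h).
have gx := allP gX x hx; have gx' := allP gX x' hx'.
have hP := perm_rem2 hx hx' xx'; set R := rem x' (rem x X) in hP.
have lev : level (x.1 + e) = level x.1 + level e by rewrite /level /=; ring.
have lev' : level (x'.1 - e) = level x'.1 - level e by rewrite /level /=; ring.
have [|||||y [y' [ey ey' gy gy' hs]]] := @refill n x x' (x.1 + e) (x'.1 - e) gx gx' f1 f2.
- by split; rewrite /=; ring.
- have m0 r : good n r -> [/\ 0 <= r.2.1.1, 0 <= r.2.1.2 & 0 <= r.2.2] by case/and5P.
  have [p1 p2 p3] := m0 _ gx; have [q1 q2 q3] := m0 _ gx'.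
  have between (a b c p q : int) : 0 <= c -> c <= b - a -> 0 <= p -> 0 <= q ->
    `|a + c| + `|b - c| <= `|a| + 2 * p + (`|b| + 2 * q) by clear; lia.
  by split; apply: between.
- by rewrite /same_parity lev addrC addKr.
- move: (good_level gx) (good_level gx') lp lt; rewrite lev.
  by move: (level x.1) (level x'.1) (level e) => a b c; clear; lia.
- move: (good_level gx) (good_level gx') lp lt; rewrite lev'.
  by move: (level x.1) (level x'.1) (level e) => a b c; clear; lia.
exists [:: y, y' & R].
  apply: linked_trans (linked_perm _ hP) _; apply: linked_pair => //=.
  by rewrite gx gx' gy gy'.
rewrite /energy (perm_big _ (perm_map fst hP)) /= !big_cons ey ey' lev lev'.
move: (\sum_(j <- _) _) lp lt => S; move: (level x.1) (level x'.1) (level e).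
clear=> a b c c0 cb; have c1 : 0 < b - a - c by lia.
by have := mulr_gt0 c0 c1; rewrite !expr2; lia.
Qed.

Lemma sum_gt0_mem (T : eqType) (f : T -> int) (s : seq T) :
  0 < \sum_(x <- s) f x -> exists2 x, x \in s & 0 < f x.
Proof.
move=> h; have [/hasP[x hx fx]|/hasPn hn] := boolP (has (fun x : T => 0 < f x) s).
  by exists x.
suff : \sum_(x <- s) f x <= 0 by rewrite leNgt h.
by rewrite big_seq sumr_le0 // => x /hn; rewrite leNgt.
Qed.

Definition dist (u v : vec3) : int :=
  `|u.1.1 - v.1.1| + `|u.1.2 - v.1.2| + `|u.2 - v.2|.

(* A unit of slack of [x] that exceeds the target [y] is exchanged with a unit
   that some profile of [X] has in a coordinate where [x] falls short. *)
Lemma unit_swap n x y X : good n x -> good n y -> all (good n) X -> x.1 = y.1 -> x.2 != y.2 ->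
  [/\ y.2.1.1 <= x.2.1.1 + \sum_(r <- X) r.2.1.1,
      y.2.1.2 <= x.2.1.2 + \sum_(r <- X) r.2.1.2 &
      y.2.2 <= x.2.2 + \sum_(r <- X) r.2.2] ->
  exists v w, [/\ w \in X, good n (x.1, x.2 + v), good n (w.1, w.2 - v),
    same_total [:: x; w] [:: (x.1, x.2 + v); (w.1, w.2 - v)] &
    dist (x.2 + v) y.2 < dist x.2 y.2].
Proof.
move=> gx gy gX exy nxy [h1 h2 h3].
have key v w : w \in X -> level v = 0 ->
   [/\ 0 <= x.2.1.1 + v.1.1, 0 <= x.2.1.2 + v.1.2 & 0 <= x.2.2 + v.2] ->
   [/\ v.1.1 <= w.2.1.1, v.1.2 <= w.2.1.2 & v.2 <= w.2.2] ->
   dist (x.2 + v) y.2 < dist x.2 y.2 ->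
   exists v w, [/\ w \in X, good n (x.1, x.2 + v), good n (w.1, w.2 - v),
    same_total [:: x; w] [:: (x.1, x.2 + v); (w.1, w.2 - v)] &
    dist (x.2 + v) y.2 < dist x.2 y.2].
  move=> hw lv [a1 a2 a3] [b1 b2 b3] hd; exists v, w.
  have /and5P[fx _ _ _ /eqP nx] := gx.
  have /and5P[fw _ _ _ /eqP nw] := allP gX _ hw.
  rewrite /level /load /= in nx nw lv.
  split=> //.
  - apply/and5P; rewrite /level /load; split=> //=; apply/eqP.
    by move: nx lv; lia_abs.
  - apply/and5P; rewrite /level /load; split=> //=; rewrite ?subr_ge0 //.
    by apply/eqP; move: nw lv; lia_abs.
  by apply: same_totalE; rewrite /load /=; split; ring.
(* Equal directions and equal lengths leave equally many pairs, so a shortage on one edge forces a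
   surplus on another. *)
have slack : level x.2 = level y.2.
  have /and5P[_ _ _ _ /eqP nx] := gx; have /and5P[_ _ _ _ /eqP ny] := gy.
  by move: nx ny; rewrite /level /load /= exy; lia_abs.
have m0 r : good n r -> [/\ 0 <= r.2.1.1, 0 <= r.2.1.2 & 0 <= r.2.2] by case/and5P.
have [p1 p2 p3] := m0 _ gx; have [q1 q2 q3] := m0 _ gy.
have find (f : profile -> int) a b : a < b -> b <= a + \sum_(r <- X) f r ->
    exists2 w, w \in X & 0 < f w.
  by move=> ab hb; apply: sum_gt0_mem; rewrite -(ltrD2l a) addr0 (lt_le_trans ab hb).
have wm w : w \in X -> [/\ 0 <= w.2.1.1, 0 <= w.2.1.2 & 0 <= w.2.2].
  by move=> hw; apply: m0; exact: (allP gX).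
have [c|[c|c]] : x.2.1.1 < y.2.1.1 \/ x.2.1.2 < y.2.1.2 \/ x.2.2 < y.2.2.
- move: slack nxy; case: (x.2) (y.2) => [[a1 a2] a3] [[b1 b2] b3].
  by rewrite /level !xpair_eqE /=; clear; lia.
- have [w hw fw] := find _ _ _ c h1; have [w1 w2 w3] := wm w hw.
  have [c'|c'] : y.2.1.2 < x.2.1.2 \/ y.2.2 < x.2.2 by move: slack c; rewrite /level; clear; lia.
    apply: (@key (1, -1, 0) w) => //; try split; rewrite /dist /=;
      move: c c' p1 p2 p3 q1 q2 q3 w1 w2 w3 fw; clear; lia.
  apply: (@key (1, 0, -1) w) => //; try split; rewrite /dist /=;
      move: c c' p1 p2 p3 q1 q2 q3 w1 w2 w3 fw; clear; lia.
- have [w hw fw] := find _ _ _ c h2; have [w1 w2 w3] := wm w hw.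
  have [c'|c'] : y.2.1.1 < x.2.1.1 \/ y.2.2 < x.2.2 by move: slack c; rewrite /level; clear; lia.
    apply: (@key (-1, 1, 0) w) => //; try split; rewrite /dist /=;
      move: c c' p1 p2 p3 q1 q2 q3 w1 w2 w3 fw; clear; lia.
  apply: (@key (0, 1, -1) w) => //; try split; rewrite /dist /=;
      move: c c' p1 p2 p3 q1 q2 q3 w1 w2 w3 fw; clear; lia.
have [w hw fw] := find _ _ _ c h3; have [w1 w2 w3] := wm w hw.
have [c'|c'] : y.2.1.1 < x.2.1.1 \/ y.2.1.2 < x.2.1.2 by move: slack c; rewrite /level; clear; lia.
  apply: (@key (-1, 0, 1) w) => //; try split; rewrite /dist /=;
    move: c c' p1 p2 p3 q1 q2 q3 w1 w2 w3 fw; clear; lia.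
apply: (@key (0, -1, 1) w) => //; try split; rewrite /dist /=;
  move: c c' p1 p2 p3 q1 q2 q3 w1 w2 w3 fw; clear; lia.
Qed.

End Reduction.

(** * Tables of back-and-forth pairs with given margins *)

Section Slack.

Implicit Types (d e : vec3) (U V F : seq vec3) (r x y w : profile) (X Y : seq profile).

Definition le3 (u v : vec3) := [&& u.1.1 <= v.1.1, u.1.2 <= v.1.2 & u.2 <= v.2].

(** The column margins of the table whose rows are the [m] parts; the row margins are fixed by
    direction and length. *)
Definition slack X : vec3 :=
  (\sum_(r <- X) r.2.1.1, \sum_(r <- X) r.2.1.2, \sum_(r <- X) r.2.2).

Lemma slack_cons x X : slack (x :: X) = x.2 + slack X.
Proof. by rewrite /slack !big_cons; case: (x.2) => [[]]. Qed.

Lemma perm_slack X Y : perm_eq X Y -> slack X = slack Y.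
Proof. by move=> h; rewrite /slack !(perm_big _ h). Qed.

Lemma good_slack n x : good n x -> le3 0 x.2.
Proof. by case/and5P=> _ h1 h2 h3 _; apply/and3P. Qed.

Lemma le3_refl (u : vec3) : le3 u u.
Proof. by rewrite /le3 !lexx. Qed.

Lemma le3_add (u v u' v' : vec3) : le3 u v -> le3 u' v' -> le3 (u + u') (v + v').
Proof. by move=> /and3P[a b c] /and3P[a' b' c']; apply/and3P; split; apply: lerD. Qed.

Lemma slack_ge0 n X : all (good n) X -> le3 0 (slack X).
Proof.
elim: X => [|x X IH] /=; first by rewrite /slack !big_nil.
case/andP=> gx /IH h; rewrite slack_cons.
by have := le3_add (good_slack gx) h; rewrite addr0.
Qed.

(** Induction on the distance from [x.2] to [y.2]: a unit exchange with some other profile brings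
    them closer and keeps all directions. *)
Lemma linked_head n y x X : all (good n) (x :: X) -> good n y -> x.1 = y.1 ->
  le3 y.2 (slack (x :: X)) ->
  exists2 X', linked n (x :: X) (y :: X') & perm_eq (map fst X') (map fst X).
Proof.
have [k hk] : exists k : nat, dist x.2 y.2 <= k%:Z.
  by exists (absz (dist x.2 y.2)); lia.
elim: k x X hk => [|k IH] x X hk gxX gy exy hs; have [gx gX] := andP gxX.
  exists X => //; rewrite (_ : x = y); first exact: linked_perm.
  move: exy hk; rewrite /dist; case: (x) (y) => [a [[b c] d]] [a' [[b' c'] d']] /= -> h.
  by congr (_, (_, _, _)); move: h; clear; lia.
have [e|ne] := eqVneq x.2 y.2.
  exists X => //; rewrite (_ : x = y); first exact: linked_perm.
  by move: exy e; case: (x) (y) => [? ?] [? ?] /= -> ->.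
rewrite slack_cons in hs; have /and3P[h1 h2 h3] := hs.
have [v [w [wX gxv gwv ht hd]]] := unit_swap gx gy gX exy ne (And3 h1 h2 h3).
have pX := perm_to_rem wX.
have gR : all (good n) (rem w X).
  by move: gX; rewrite -/(all _ _) (perm_all _ pX) => /andP[].
have [|||||X' hX' pX'] := IH (x.1, x.2 + v) ((w.1, w.2 - v) :: rem w X) => //.
- by move: hk hd => /=; move: (dist _ _) (dist _ _) => a b; clear; lia.
- by rewrite /= gxv gwv.
- rewrite !slack_cons /= (_ : x.2 + v + (w.2 - v + slack (rem w X)) = x.2 + slack X) //.
  by rewrite (perm_slack pX) slack_cons addrA -(addrA x.2) (addrCA v) subrr addr0 addrA.
exists X'; last first.
  by apply: perm_trans pX' _; rewrite perm_sym; exact: (perm_map fst pX).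
apply: linked_trans hX'; apply: linked_trans (linked_perm _ (_ : perm_eq _ (x :: w :: rem w X))) _.
  by rewrite perm_cons.
apply: linked_pair => //=; rewrite gx gxv gwv !andbT.
exact: (allP gX).
Qed.

(** Equal directions contribute equal absolute values to the loads; what remains is twice the
    slack. *)
Lemma load_slack X Y : perm_eq (map fst X) (map fst Y) -> same_total X Y ->
  slack X = slack Y.
Proof.
move=> hp [_ [_]]; rewrite !big_map /load /= !big_split /= -!mulr_sumr.
have P (f : vec3 -> int) : \sum_(r <- X) f r.1 = \sum_(r <- Y) f r.1.
  by rewrite -(big_map fst xpredT f) -[RHS](big_map fst xpredT f); exact: perm_big.
rewrite (P (fun d => `|d.1.1|)) (P (fun d => `|d.1.2|)) (P (fun d => `|d.2|)).
move=> /addrI h1 /addrI h2 /addrI h3.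
by rewrite /slack; congr (_, _, _); apply: (@mulfI _ (2 : int)).
Qed.

(** A profile of [X] with the direction of the head of [Y] is turned into that head, which is then
    set aside. *)
Lemma linked_same_directions n X Y : all (good n) X -> all (good n) Y ->
  perm_eq (map fst X) (map fst Y) -> same_total X Y -> linked n X Y.
Proof.
elim: Y X => [|y Y IH] X gX gY hp ht.
  apply: linked_perm; have := perm_size hp; rewrite !size_map => /size0nil -> //.
have /mapP[x xX exy] : y.1 \in map fst X by rewrite (perm_mem hp) mem_head.
have pX := perm_to_rem xX; set R := rem x X in pX.
have gxR : all (good n) (x :: R) by rewrite -(perm_all _ pX).
have [gy gY'] := andP gY.
have [|X' hX' pX'] := linked_head gxR gy (esym exy).
  rewrite -(perm_slack pX) (load_slack hp ht) slack_cons.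
  by have := le3_add (le3_refl y.2) (slack_ge0 gY'); rewrite addr0.
have cX := linked_trans (linked_perm n pX) hX'.
apply: (linked_trans cX); apply: linked_cons.
have gyX' := linked_good hX' gxR.
apply: IH => //.
- by case/andP: gyX'.
- apply: perm_trans pX' _.
  have := perm_map fst pX; rewrite perm_sym => h.
  by have := perm_trans h hp; rewrite /= -exy perm_cons.
apply: (@same_total_catIr [:: y]).
have tX := same_total_sym (linked_total cX).
have P Z : perm_eq (Z ++ [:: y]) (y :: Z) by rewrite cats1 perm_rcons.
apply: same_total_trans (perm_same_total (P X')) _.
apply: same_total_trans (same_total_trans tX ht) _.
by apply: perm_same_total; rewrite perm_sym P.
Qed.

End Slack.

(** * Exchanging pairs of opposite octahedron vertices *)

Section Exchange.

Implicit Types (d e u v : vec3) (U V F : seq vec3) (r x y : profile) (X Y : seq profile).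

Definition units : seq vec3 := [:: (1,0,0); (0,1,0); (0,0,1)].

Lemma unitsP v : v \in units ->
  [/\ level v = 1, flat v & [/\ 0 <= v.1.1 <= 1, 0 <= v.1.2 <= 1 & 0 <= v.2 <= 1]].
Proof.
have h : all (fun v => [&& level v == 1, flat v & [&& 0 <= v.1.1 <= 1, 0 <= v.1.2 <= 1 & 0 <= v.2 <= 1]]) units by [].
by move/(allP h)=> /and3P[/eqP-> -> /and3P].
Qed.

Lemma flatN d : flat (- d) = flat d.
Proof.
have E (a b : int) : `|- a - - b| = `|a - b| by rewrite -opprD normrN.
by rewrite /flat /= !E.
Qed.

Lemma levelN d : level (- d) = - level d.
Proof. by rewrite /level /=; ring. Qed.

(** A flat direction of level 1 uses a single step, so for $n>1$ the profile [x] owns some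
    back-and-forth pair. If it has none on the edge [w], it trades one on another edge [c] for
    it. *)
Lemma borrow_unit n w x X : (1 < n)%N -> all (good n) (x :: X) -> w \in units ->
  level x.1 = 1 -> le3 w (slack (x :: X)) ->
  exists y X', [/\ linked n (x :: X) (y :: X'), y.1 = x.1, le3 w y.2 &
    perm_eq (map fst X') (map fst X)].
Proof.
move=> n1 gX hw lx hs; have /andP[gx gX'] := gX.
have [hwx|hwx] := boolP (le3 w x.2); first by exists x, X; split => //; exact: linked_perm.
have [c hc hcx] : exists2 c, c \in units & c != w /\ le3 c x.2.
  have /and5P[fx s1 s2 s3 /eqP nx] := gx.
  have ld : `|x.1.1.1| + `|x.1.1.2| + `|x.1.2| = 1.
    by move: fx lx; rewrite /flat /level; clear; lia.
  have : 0 < x.2.1.1 + x.2.1.2 + x.2.2.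
    by move: nx ld n1; rewrite /level /load /=; lia_abs.
  have give c : c \in units -> le3 c x.2 -> exists2 c, c \in units & c != w /\ le3 c x.2.
    by move=> hc h; exists c => //; split=> //; apply: contraNneq hwx => <-.
  move=> hpos; have [h|[h|h]] : 0 < x.2.1.1 \/ 0 < x.2.1.2 \/ 0 < x.2.2.
  - by move: hpos; clear; lia.
  - by apply: (give (1,0,0)) => //; move: s1 s2 s3 h; rewrite /le3 /=; clear; lia.
  - by apply: (give (0,1,0)) => //; move: s1 s2 s3 h; rewrite /le3 /=; clear; lia.
  by apply: (give (0,0,1)) => //; move: s1 s2 s3 h; rewrite /le3 /=; clear; lia.
have [cw cx] := hcx.
have [lw _ [w1 w2 w3]] := unitsP hw; have [lc _ [c1 c2 c3]] := unitsP hc.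
have wc : [/\ w.1.1 + c.1.1 <= 1, w.1.2 + c.1.2 <= 1 & w.2 + c.2 <= 1].
  have h : all (fun w => all (fun c => (c != w) ==>
    [&& w.1.1 + c.1.1 <= 1, w.1.2 + c.1.2 <= 1 & w.2 + c.2 <= 1]) units) units by [].
  by apply/and3P; exact: (implyP (allP (allP h w hw) c hc)).
have /and5P[fx s1 s2 s3 /eqP nx] := gx; have /and3P[b1 b2 b3] := cx.
have /and3P[S1 S2 S3] := slack_ge0 gX'.
have gy : good n (x.1, x.2 + (w - c)).
  apply/and5P; split=> //=; [move: b1 w1|move: b2 w2|move: b3 w3|]; try by clear; lia.
  by apply/eqP; rewrite -nx; move: lw lc; rewrite /level /load /=; lia_abs.
have [|X' hX' pX'] := linked_head gX gy (erefl _).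
  rewrite slack_cons; apply: le3_add (le3_refl _) _ => /=.
  have {hw} ew : w = (1,0,0) \/ w = (0,1,0) \/ w = (0,0,1).
    by move: hw; rewrite !inE => /or3P[]/eqP; auto.
  rewrite slack_cons in hs; move: (x.2) (slack X) (c) hs hwx c1 c2 c3 s1 s2 s3 S1 S2 S3; rewrite /le3.
  by case: ew => [|[|]] -> /=; clear=> -[[? ?] ?] [[? ?] ?] [[? ?] ?] /=; lia.
exists (x.1, x.2 + (w - c)), X'; split=> //.
by rewrite /le3 /=; move: b1 b2 b3; clear; lia.
Qed.

(* For [k = 0] the new directions [w] and [- w] have opposite signs, and replacing
   [v] and [- v] by them uses up a back-and-forth pair on the edge [w]. *)
Lemma exchange n k v w X : (1 < n)%N -> all (good n) X ->
  v \in units -> w \in units ->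
  shift k v \in map fst X -> shift k (- v) \in map fst X ->
  (k = 0 -> le3 w (slack X)) ->
  exists2 X', linked n X X' &
    perm_eq [:: shift k v, shift k (- v) & map fst X']
            [:: shift k w, shift k (- w) & map fst X].
Proof.
move=> n1 gX hv hw /mapP[x xX ex] /mapP[x' x'X ex'] hk.
have [lv fv [v1 v2 v3]] := unitsP hv; have [lw fw [w1 w2 w3]] := unitsP hw.
have pX := perm_to_rem xX; set R := rem x X in pX.
have gxR : all (good n) (x :: R) by rewrite -(perm_all _ pX).
have xx' : x' != x.
  apply/eqP=> e; have : level (shift k v) = level (shift k (- v)) by rewrite ex ex' e.
  by rewrite !level_shift levelN lv => /addIr.
have [y [X1 [cX ey hy pX1]]] : exists y X1, [/\ linked n (x :: R) (y :: X1), y.1 = x.1,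
    k = 0 -> le3 w y.2 & perm_eq (map fst X1) (map fst R)].
  have [k0|k0] := eqVneq k 0; last first.
    by exists x, R; split => //; [exact: linked_perm | move=> e; rewrite e eqxx in k0].
  have [||y [X1 [h1 h2 h3 h4]]] := borrow_unit n1 gxR hw.
  - by rewrite -ex level_shift lv k0.
  - by rewrite -(perm_slack pX) hk.
  by exists y, X1.
have gyX1 := linked_good cX gxR; have [gy gX1] := andP gyX1.
have /mapP[z zX1 ez] : shift k (- v) \in map fst X1.
  rewrite (perm_mem pX1) ex'; apply: map_f.
  by move: x'X; rewrite (perm_mem pX) inE (negPf xx').
have gz := allP gX1 z zX1.
have lev1 : level (shift k w) = level y.1 by rewrite ey -ex !level_shift lv lw.
have lev2 : level (shift k (- w)) = level z.1 by rewrite -ez !level_shift !levelN lv lw.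
have [|||||||y' [z' [ey' ez' gy' gz' ht]]] := @refill n y z (shift k w) (shift k (- w)) gy gz.
- by rewrite flat_shift.
- by rewrite flat_shift flatN.
- by rewrite ey -ex -ez /shift /=; split; ring.
(* For nonzero [k] both sums of absolute values equal $2|k|$; only at [k = 0] does the new pair cost
   $2b$, paid for by a pair on that edge. *)
- have sc (a b m m' : int) : 0 <= a <= 1 -> 0 <= b <= 1 -> 0 <= m -> 0 <= m' ->
      (k <> 0 \/ b <= m) -> `|b + k| + `|- b + k| <= `|a + k| + 2 * m + (`|- a + k| + 2 * m').
    by clear; lia.
  have /and3P[m1 m2 m3] := good_slack gy; have /and3P[q1 q2 q3] := good_slack gz.
  have hy' : k <> 0 \/ le3 w y.2.
    by have [k0|/eqP k0] := eqVneq k 0; [right; apply: hy|left].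
  rewrite /load ey -ex -ez /shift /=; split; apply: sc => //.
  + by case: hy' => [|/and3P[]]; [left|right].
  + by case: hy' => [|/and3P[]]; [left|right].
  by case: hy' => [|/and3P[]]; [left|right].
- by rewrite /same_parity lev1 subrr.
- by rewrite lev1 good_level.
- by rewrite lev2 good_level.
have pz := perm_to_rem zX1.
exists [:: y', z' & rem z X1].
  apply: linked_trans (linked_perm _ pX) _; apply: linked_trans cX _.
  apply: (@linked_trans _ [:: y, z & rem z X1]); first by apply: linked_perm; rewrite perm_cons.
  by apply: linked_pair => //=; rewrite gy gz gy' gz'.
rewrite /= ey' ez'.
have h : perm_eq (map fst X) [:: shift k v, shift k (- v) & map fst (rem z X1)].
  apply: perm_trans (perm_map fst pX) _; rewrite /= -ex perm_cons.
  apply: perm_trans (_ : perm_eq _ (map fst X1)) _; first by rewrite perm_sym.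
  by apply: perm_trans (perm_map fst pz) _; rewrite /= -ez.
rewrite perm_sym; set S := map fst (rem z X1) in h *.
have -> : [:: shift k w, shift k (- w) & map fst X] = [:: shift k w; shift k (- w)] ++ map fst X by [].
apply: (@perm_trans _ ([:: shift k w; shift k (- w)] ++ [:: shift k v, shift k (- v) & S])).
  by rewrite perm_cat2l.
have -> : [:: shift k v, shift k (- v), shift k w, shift k (- w) & S] =
  [:: shift k v; shift k (- v)] ++ [:: shift k w; shift k (- w)] ++ S by [].
exact: permEl (perm_catCA [:: _; _] [:: _; _] S).
Qed.

End Exchange.

(** * Connecting two profile multisets with the same totals *)

Section Fiber.

Implicit Types (d e u v : vec3) (U V F : seq vec3) (r x y : profile) (X Y : seq profile).

Definition signed_units : seq vec3 :=
  [:: (1,0,0); (0,1,0); (0,0,1); (-1,0,0); (0,-1,0); (0,0,-1)].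

(** The level modulo 3 decides: a base point of level 1 is a unit vector, and one of level 2 is
    (1,1,1) minus a unit vector. *)
Lemma mem_signed_units k d : flat d -> level d = 3 * k - 1 \/ level d = 3 * k + 1 ->
  d \in map (shift k) signed_units.
Proof.
move=> /flatP[j [p hp ->]]; rewrite level_shift => hl.
have h : all (fun p => [|| level p == 0, (level p == 1) && (p \in signed_units) |
   (level p == 2) && (shift (-1) p \in signed_units)]) base_points by [].
have /or3P[/eqP lp|/andP[/eqP lp pu]|/andP[/eqP lp pu]] := allP h p hp; rewrite lp in hl.
- by exfalso; move: hl; clear; lia.
- by rewrite (_ : j = k) ?map_f //; move: hl; clear; lia.
rewrite (_ : j = -1 + k); last by move: hl; clear; lia.
by rewrite -shift_add map_f.
Qed.

Definition mult k (U : seq vec3) v : int := (count_mem (shift k v) U)%:Z.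

(** The adjusted constant term expresses [f] in coordinates centred at $(k,k,k)$. *)
Lemma sum_by_mult k f U : {subset U <= map (shift k) signed_units} ->
  \sum_(d <- U) affine (f.1 - level f.2 * k, f.2) d =
  \sum_(p <- signed_units) affine f p * mult k U p.
Proof.
move=> hU; rewrite (sum_by_count _ _ hU); last first.
  by rewrite map_inj_uniq //; exact: inj_shift.
rewrite big_map; apply: eq_bigr => p _; rewrite /mult affine_shift; congr (_ * _).
by rewrite /affine /=; ring.
Qed.

(** The coordinate sums fix the differences between opposite multiplicities; with the size they also
    fix the total over the positive vertices. *)
Lemma mult_eqs k U V : same_sum U V ->
  {subset U <= map (shift k) signed_units} -> {subset V <= map (shift k) signed_units} ->
  let a := mult k U in let b := mult k V in
  [/\ a (1,0,0) - a (-1,0,0) = b (1,0,0) - b (-1,0,0),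
      a (0,1,0) - a (0,-1,0) = b (0,1,0) - b (0,-1,0),
      a (0,0,1) - a (0,0,-1) = b (0,0,1) - b (0,0,-1) &
      a (1,0,0) + a (0,1,0) + a (0,0,1) = b (1,0,0) + b (0,1,0) + b (0,0,1)].
Proof.
move=> hs hU hV a b.
have E f : \sum_(p <- signed_units) affine f p * a p = \sum_(p <- signed_units) affine f p * b p.
  by rewrite -!sum_by_mult // (same_sum_affine _ hs).
have := E (0, (0, 0, 1)); have := E (0, (0, 1, 0)); have := E (0, (1, 0, 0)).
have := E (1, (0, 0, 0)); rewrite /signed_units !big_cons !big_nil /affine /=.
move: (a _) (a _) (a _) (a _) (a _) (a _) => a1 a2 a3 a4 a5 a6.
move: (b _) (b _) (b _) (b _) (b _) (b _) => b1 b2 b3 b4 b5 b6.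
by clear; split; lia.
Qed.

Lemma load_sums X :
  [/\ \sum_(d <- map load X) d.1.1 = \sum_(d <- map fst X) `|d.1.1| + 2 * (slack X).1.1,
      \sum_(d <- map load X) d.1.2 = \sum_(d <- map fst X) `|d.1.2| + 2 * (slack X).1.2 &
      \sum_(d <- map load X) d.2 = \sum_(d <- map fst X) `|d.2| + 2 * (slack X).2].
Proof. by split; rewrite !big_map big_split /= -mulr_sumr. Qed.

(** Opposite multiplicities differ equally in [X] and [Y], so [Y] has as many extra copies of $-w$
    as of $w$. It spends more load on that edge through directions, and [X] must hold the difference
    as pairs. *)
Lemma slack_deficit n X Y w : all (good n) X -> all (good n) Y -> same_total X Y ->
  {subset map fst X <= map (shift 0) signed_units} ->
  {subset map fst Y <= map (shift 0) signed_units} ->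
  w \in units -> mult 0 (map fst X) w < mult 0 (map fst Y) w -> le3 w (slack X).
Proof.
move=> gX gY [h1 [_ e1 e2 e3]] hX hY hw lw.
have [m1 m2 m3 _] := mult_eqs h1 hX hY.
have /and3P[x1 x2 x3] := slack_ge0 gX; have /and3P[y1 y2 y3] := slack_ge0 gY.
have A (f : vec3 -> int) Z : {subset map fst Z <= map (shift 0) signed_units} ->
    \sum_(d <- map fst Z) f d = \sum_(p <- signed_units) f p * mult 0 (map fst Z) p.
  move=> hZ; rewrite (sum_by_count _ _ hZ).
    by rewrite big_map; apply: eq_bigr => p _; rewrite shift0 /mult shift0.
  by rewrite map_inj_uniq //; exact: inj_shift.
have [lx1 lx2 lx3] := load_sums X; have [ly1 ly2 ly3] := load_sums Y.
rewrite lx1 ly1 !A // in e1; rewrite lx2 ly2 !A // in e2; rewrite lx3 ly3 !A // in e3.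
rewrite /signed_units !big_cons !big_nil in e1 e2 e3.
have ew : w = (1,0,0) \/ w = (0,1,0) \/ w = (0,0,1).
  by move: hw; rewrite !inE => /or3P[]/eqP; auto.
move: m1 m2 m3 x1 x2 x3 y1 y2 y3 e1 e2 e3 lw; rewrite /le3.
move: (mult _ _) (mult _ _) (slack X) (slack Y) => a b S T.
case: S T => [[S1 S2] S3] [[T1 T2] T3].
clear - ew; case: ew => [|[|]] -> /=; rewrite ?(normrN1, normr0, normr1, mul0r, mul1r);
move: (a _) (a _) (a _) (a _) (a _) (a _) => a1 a2 a3 a4 a5 a6;
move: (b _) (b _) (b _) (b _) (b _) (b _) => b1 b2 b3 b4 b5 b6; clear; lia.

Qed.

(** Induction on [gap]. The positive multiplicities have equal totals, so unless they agree some [v]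
    is too frequent in [X] and some [w] too rare; $-v$ is then too frequent as well, and an exchange
    narrows the gap. *)
Lemma linked_octahedron n k X Y : (1 < n)%N -> all (good n) X -> all (good n) Y ->
  same_total X Y ->
  {in map fst X ++ map fst Y, forall d, level d = 3 * k - 1 \/ level d = 3 * k + 1} ->
  linked n X Y.
Proof.
move=> n1 gX gY ht hl.
pose gap (Z : seq profile) := \sum_(p <- units) `|mult k (map fst Z) p - mult k (map fst Y) p|.
have oct Z : all (good n) Z ->
    {in map fst Z, forall d, level d = 3 * k - 1 \/ level d = 3 * k + 1} ->
    {subset map fst Z <= map (shift k) signed_units}.
  move=> gZ hZ d hd; apply: mem_signed_units; last exact: hZ.
  by have /mapP[r hr ->] := hd; apply: good_flat; exact: (allP gZ).
have oY : {subset map fst Y <= map (shift k) signed_units}.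
  by apply: oct => // d hd; apply: hl; rewrite mem_cat hd orbT.
have {hl} oX : {subset map fst X <= map (shift k) signed_units}.
  by apply: oct => // d hd; apply: hl; rewrite mem_cat hd.
have [m hm] : exists m : nat, gap X <= m%:Z by exists (absz (gap X)); lia.
elim: m X hm gX ht oX => [|m IH] X hm gX ht oX.
  apply: linked_same_directions => //; apply: (perm_eq_count oX oY).
  have [m1 m2 m3 m4] := mult_eqs ht.1 oX oY.
  move: m1 m2 m3 hm; rewrite /gap /units !big_cons big_nil => m1 m2 m3 hm.
  have e : all (fun p => mult k (map fst X) p == mult k (map fst Y) p) signed_units.
    rewrite /=; move: m1 m2 m3 m4 hm; clear; move: (mult _ _) (mult _ _) => a b.
    move: (a _) (a _) (a _) (a _) (a _) (a _) => a1 a2 a3 a4 a5 a6.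
    by move: (b _) (b _) (b _) (b _) (b _) (b _) => b1 b2 b3 b4 b5 b6; clear; lia.
  by move=> _ /mapP[p hp ->]; apply/eqP; exact: (allP e).
have [m1 m2 m3 m4] := mult_eqs ht.1 oX oY.
have [/eqP gap0|gapn] := boolP (gap X == 0); first by apply: IH => //; rewrite gap0.
have unitsE u : u \in units -> [\/ u = (1,0,0), u = (0,1,0) | u = (0,0,1)].
  by rewrite !inE => /or3P[]/eqP->; [constructor 1|constructor 2|constructor 3].
have step v w : v \in units -> w \in units ->
    mult k (map fst Y) v < mult k (map fst X) v ->
    mult k (map fst Y) (- v) < mult k (map fst X) (- v) ->
    mult k (map fst X) w < mult k (map fst Y) w -> linked n X Y.
  move=> hv hw l1 l2 l3.
  have mem u : mult k (map fst Y) u < mult k (map fst X) u -> shift k u \in map fst X.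
    by rewrite /mult -has_pred1 has_count; clear; lia.
  have [|X' cX pX] := exchange n1 gX hv hw (mem _ l1) (mem _ l2).
    by move=> k0; subst k; apply: (slack_deficit gX gY).
  have upd p : p \in units -> mult k (map fst X') p =
      mult k (map fst X) p + (w == p)%:Z - (v == p)%:Z.
    move=> hp; have := permP pX (pred1 (shift k p)); rewrite /= !(inj_eq (@inj_shift k)).
    have N u : u \in units -> (- u == p) = false.
      move=> hu; apply/eqP=> e; have := levelN u; rewrite e.
      by have [-> _ _] := unitsP hu; have [-> _ _] := unitsP hp.
    rewrite !N //= !add0n => /(congr1 Posz); rewrite !PoszD => e.
    by apply: (addrI (v == p)%:Z); rewrite [LHS]e /mult; ring.
  apply: (linked_trans cX); apply: IH.
  - move: hm; rewrite /gap /units !big_cons !big_nil !upd //.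
    have := l3; have := l1; case: (unitsE v hv) => ->; case: (unitsE w hw) => -> /=;
    move: (mult _ _) (mult _ _) => a b; move: (a _) (a _) (a _) => a1 a2 a3;
    by move: (b _) (b _) (b _) => b1 b2 b3; clear; lia.
  - exact: linked_good cX gX.
  - exact: same_total_trans (same_total_sym (linked_total cX)) ht.
  move=> d hd; have : d \in [:: shift k w, shift k (- w) & map fst X].
    by rewrite -(perm_mem pX) !inE hd !orbT.
  case/predU1P=> [->|/predU1P[->|/oX//]].
    by apply: (map_f (shift k)); case: (unitsE w hw) => ->.
  by apply: (map_f (shift k)); case: (unitsE w hw) => ->.
move: (step (1,0,0) (0,1,0)) (step (1,0,0) (0,0,1)) (step (0,1,0) (1,0,0))
  (step (0,1,0) (0,0,1)) (step (0,0,1) (1,0,0)) (step (0,0,1) (0,1,0)).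
have -> : - ((1,0,0) : vec3) = (-1,0,0) by [].
have -> : - ((0,1,0) : vec3) = (0,-1,0) by [].
have -> : - ((0,0,1) : vec3) = (0,0,-1) by [].
move: gapn m1 m2 m3 m4; rewrite /gap /units !big_cons !big_nil; clear.
move: (linked n X Y) => P; move: (mult _ _) (mult _ _) => a b.
move: (a _) (a _) (a _) (a _) (a _) (a _) => a1 a2 a3 a4 a5 a6.
move: (b _) (b _) (b _) (b _) (b _) (b _) => b1 b2 b3 b4 b5 b6.
move=> g m1 m2 m3 m4 s12 s13 s21 s23 s31 s32.
have [c|[c|[c|[c|[c|c]]]]] : (a6 < b6 /\ b5 < a5) \/ (a6 < b6 /\ b4 < a4) \/
    (a5 < b5 /\ b6 < a6) \/ (a5 < b5 /\ b4 < a4) \/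
    (a4 < b4 /\ b6 < a6) \/ (a4 < b4 /\ b5 < a5).
- by move: g m4; clear; lia.
- by apply: s12 => //; move: m1 m2 m3 c; clear; lia.
- by apply: s13 => //; move: m1 m2 m3 c; clear; lia.
- by apply: s21 => //; move: m1 m2 m3 c; clear; lia.
- by apply: s23 => //; move: m1 m2 m3 c; clear; lia.
- by apply: s31 => //; move: m1 m2 m3 c; clear; lia.
by apply: s32 => //; move: m1 m2 m3 c; clear; lia.
Qed.

(** Descent on the joint energy, always acting on the side of larger energy. When that side is
    irreducible, the other has no larger energy, as [irreducible_perm] requires. *)
Lemma linked_fiber n X Y : (1 < n)%N -> all (good n) X -> all (good n) Y ->
  same_total X Y -> linked n X Y.
Proof.
move=> n1.
have E0 (Z : seq profile) : 0 <= energy (map fst Z) by apply: sumr_ge0 => d _; apply: sqr_ge0.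
have [m hm] : exists m : nat, energy (map fst X) + energy (map fst Y) < m%:Z.
  by exists (absz (energy (map fst X) + energy (map fst Y))%R).+1; lia.
elim: m X Y hm => [|m IH] X Y hm gX gY ht.
  by have := addr_ge0 (E0 X) (E0 Y); rewrite leNgt hm.
wlog hE : X Y hm gX gY ht / energy (map fst Y) <= energy (map fst X).
  move=> H; have [h|/ltW h] := leP (energy (map fst Y)) (energy (map fst X)); first exact: H.
  by apply: linked_sym; apply: H => //; [rewrite addrC | exact: same_total_sym].
have [irr|[X' cX lX]] := energy_reduce gX; last first.
  apply: (linked_trans cX); apply: IH => //.
  - by move: hm lX; move: (energy _) (energy _) (energy _) => a b c; clear; lia.
  - exact: linked_good cX gX.
  exact: same_total_trans (same_total_sym (linked_total cX)) ht.
have gXY : all (good n) (X ++ Y) by rewrite all_cat gX.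
have lift (P : vec3 -> Prop) : (forall r, good n r -> P r.1) ->
    {in map fst X ++ map fst Y, forall d, P d}.
  by move=> h d; rewrite -map_cat => /mapP[r hr ->]; apply: h; exact: (allP gXY).
have [||hp|[k hk]] := irreducible_perm _ _ irr ht.1 hE.
- by apply: lift => r; exact: good_flat.
- have par := lift (fun d => (2 %| n%:Z - level d)%Z) (@good_parity n).
  move=> d e hd he; have := rpredB (par e he) (par d hd).
  by rewrite /same_parity opprB addrC addrA subrK.
- exact: linked_same_directions.
exact: linked_octahedron hk.
Qed.

End Fiber.

(** * Profiles of walks on three states *)

Section Walks.

Definition a0 : 'I_3 := @Ordinal 3 0 isT.
Definition a1 : 'I_3 := @Ordinal 3 1 isT.
Definition a2 : 'I_3 := @Ordinal 3 2 isT.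

Lemma I3P (x : 'I_3) : [\/ x = a0, x = a1 | x = a2].
Proof.
by case: x => [[|[|[|]]]] // h; [constructor 1|constructor 2|constructor 3]; apply: val_inj.
Qed.

Definition arcs (x : 'I_3) (p : seq 'I_3) (a : 'I_3 * 'I_3) : int :=
  (count_mem a (pairmap pair x p))%:Z.

Definition forth (c : 'I_3 * 'I_3 -> int) : vec3 := (c (a0, a1), c (a1, a2), c (a2, a0)).
Definition back (c : 'I_3 * 'I_3 -> int) : vec3 := (c (a1, a0), c (a2, a1), c (a0, a2)).

Definition arc (x y : 'I_3) (a : 'I_3 * 'I_3) : int := ((x, y) == a)%:Z.

Lemma forth_cons x y p : forth (arcs x (y :: p)) = forth (arc x y) + forth (arcs y p).
Proof. by rewrite /forth /arcs /= !PoszD. Qed.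

Lemma back_cons x y p : back (arcs x (y :: p)) = back (arc x y) + back (arcs y p).
Proof. by rewrite /back /arcs /= !PoszD. Qed.

Definition to_profile (f b : vec3) : profile :=
  (f - b, (Num.min f.1.1 b.1.1, Num.min f.1.2 b.1.2, Num.min f.2 b.2)).

Definition is_walk (x : 'I_3) (p : seq 'I_3) := path (fun a b => a != b) x p.

(** Flow conservation at the three states: net outflow is the indicator of the start minus that of
    the end. *)
Lemma walk_balance x p : is_walk x p ->
  let d := forth (arcs x p) - back (arcs x p) in let y := last x p in
  [/\ d.1.1 - d.2 = (x == a0)%:Z - (y == a0)%:Z,
      d.1.2 - d.1.1 = (x == a1)%:Z - (y == a1)%:Z,
      d.2 - d.1.2 = (x == a2)%:Z - (y == a2)%:Z &
      level (forth (arcs x p)) + level (back (arcs x p)) = (size p)%:Z].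
Proof.
cbv zeta; elim: p x => [|y p IH] x.
  by move=> _ /=; split; rewrite ?subrr.
case/andP=> xy /IH {IH}; rewrite forth_cons back_cons.
move: (forth (arcs y p)) (back (arcs y p)) => [[f1 f2] f3] [[b1 b2] b3] /=.
rewrite /level /=.
move: (last y p) xy => z.
have [->|->|->] := I3P x; have [->|->|->] := I3P y => //= _; rewrite /arc /=;
move: (z == a0) (z == a1) (z == a2) => za zb zc; clear=> -[e1 e2 e3 e4]; split; lia.
Qed.

(** The necessary half of Euler's criterion: flatness holds because differences of indicators have
    this form. *)
Lemma good_walk x p : is_walk x p ->
  good (size p) (to_profile (forth (arcs x p)) (back (arcs x p))).
Proof.
move=> hw; have [e1 e2 e3 e4] := walk_balance hw.
have P a : 0 <= arcs x p a by [].
have /= := P (a0, a1); have /= := P (a1, a2); have /= := P (a2, a0).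
have /= := P (a1, a0); have /= := P (a2, a1); have /= := P (a0, a2).
move: e1 e2 e3 e4; rewrite /good /to_profile /load /flat /level /forth /back /=.
move: (x == _) (x == _) (x == _) (last x p == _) (last x p == _) (last x p == _) => b1 b2 b3 b4 b5 b6.
clear P; move: (arcs x p) => c; move: (c _) (c _) (c _) (c _) (c _) (c _).
clear=> c1 c2 c3 c4 c5 c6 e1 e2 e3 e4 p1 p2 p3 p4 p5 p6.
apply/and5P; split; [apply/and3P; split|..]; lia.
Qed.

(** The walk must have a first step: it then visits two distinct states, and every edge of the
    triangle meets one of them. *)
Definition walkable (f b : vec3) := exists x y p,
  [/\ is_walk x (y :: p), forth (arcs x (y :: p)) = f & back (arcs x (y :: p)) = b].

(** A back-and-forth step is inserted at whichever of the first two states lies on the edge [u]. *)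
Lemma walkable_detour u f b : u \in units -> walkable f b -> walkable (f + u) (b + u).
Proof.
move=> hu [x [y [p [hw <- <-]]]].
have /andP[xy hp] := hw.
have [[z [zx e1 e2]]|[z [zy e1 e2]]] :
   (exists z, [/\ x != z, forth (arc x z) + forth (arc z x) = u &
     back (arc x z) + back (arc z x) = u]) \/
   (exists z, [/\ y != z, forth (arc y z) + forth (arc z y) = u &
     back (arc y z) + back (arc z y) = u]).
- have eu : u = (1,0,0) \/ u = (0,1,0) \/ u = (0,0,1).
    by move: hu; rewrite !inE => /or3P[]/eqP; auto.
  move: xy {hw hp}; case: eu => [|[|]] ->; have [->|->|->] := I3P x; have [->|->|->] := I3P y => //= _;
  first [ by left; exists a0 | by left; exists a1 | by left; exists a2 |
          by right; exists a0 | by right; exists a1 | by right; exists a2 ].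
- exists x, z, (x :: y :: p); split; first by rewrite /is_walk /= zx eq_sym zx.
    by rewrite (forth_cons x z) (forth_cons z x) addrA e1 addrC.
  by rewrite (back_cons x z) (back_cons z x) addrA e2 addrC.
exists x, y, (z :: y :: p); split; first by rewrite /is_walk /= xy zy eq_sym zy.
  by rewrite !(forth_cons x y) (forth_cons y z) (forth_cons z y) -[in RHS]addrA; congr (_ + _); rewrite addrA e1 addrC.
by rewrite !(back_cons x y) (back_cons y z) (back_cons z y) -[in RHS]addrA; congr (_ + _); rewrite addrA e2 addrC.
Qed.

(** A tour of the triangle, in either orientation, is prefixed at the starting state. *)
Lemma walkable_cycle f b : walkable f b ->
  walkable (f + (1,1,1)) b /\ walkable f (b + (1,1,1)).
Proof.
move=> [x [y [p [hw <- <-]]]].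
have [z [t [[h1 h2 h3] ef eb ef' eb']]] : exists z t, [/\ [/\ x != z, z != t & t != x],
   forth (arc x z) + forth (arc z t) + forth (arc t x) = (1,1,1),
   back (arc x z) + back (arc z t) + back (arc t x) = 0,
   forth (arc x t) + forth (arc t z) + forth (arc z x) = 0 &
   back (arc x t) + back (arc t z) + back (arc z x) = (1,1,1)].
  by have [->|->|->] := I3P x; [exists a1, a2|exists a2, a0|exists a0, a1].
split; [exists x, z, (t :: x :: y :: p)|exists x, t, (z :: x :: y :: p)]; split.
- by rewrite /is_walk /= h1 h2 h3.
- by rewrite (forth_cons x z) (forth_cons z t) (forth_cons t x) !addrA ef addrC.
- by rewrite (back_cons x z) (back_cons z t) (back_cons t x) !addrA eb add0r.
- by rewrite /is_walk /= eq_sym h3 eq_sym h2 eq_sym h1.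
- by rewrite (forth_cons x t) (forth_cons t z) (forth_cons z x) !addrA ef' add0r.
by rewrite (back_cons x t) (back_cons t z) (back_cons z x) !addrA eb' addrC.
Qed.

Lemma walkable_small d : d \in (1,1,1) :: behead base_points -> walkable d 0 /\ walkable 0 d.
Proof.
rewrite !inE; do 6?[case/orP]; move/eqP=> ->.
- by split; [exists a0, a1, [:: a2; a0]|exists a0, a2, [:: a1; a0]].
- by split; [exists a0, a1, [::]|exists a1, a0, [::]].
- by split; [exists a1, a2, [::]|exists a2, a1, [::]].
- by split; [exists a2, a0, [::]|exists a0, a2, [::]].
- by split; [exists a1, a2, [:: a0]|exists a0, a2, [:: a1]].
- by split; [exists a2, a0, [:: a1]|exists a1, a0, [:: a2]].
by split; [exists a0, a1, [:: a2]|exists a2, a1, [:: a0]].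
Qed.

End Walks.

(** * Realizing profiles by walks, and walks by words *)

Section Words.

Implicit Types (d e u v : vec3) (r : profile).

(** A short walk for the base point is extended by full tours; over the zero base point the first
    tour itself starts the walk. *)
Lemma walkable_flat d : flat d -> le3 0 d -> d != 0 -> walkable d 0 /\ walkable 0 d.
Proof.
move=> /flatP[j [p hp ->]] hd.
have [k ->] : exists k : nat, j = k%:Z.
  have h : all (fun p : vec3 => [|| p.1.1 == 0, p.1.2 == 0 | p.2 == 0]) base_points by [].
  have hj : 0 <= j.
    by move: (allP h p hp) hd; case: (p) => [[a b] c]; rewrite /le3 /=; clear; lia.
  by exists (absz j); lia.
elim: k {hd} => [|k IH].
  rewrite shift0 => p0; apply: walkable_small; move: hp p0.
  by rewrite /base_points inE => /predU1P[->|h _]; rewrite // inE h orbT.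
rewrite (_ : (k.+1)%:Z = k%:Z + 1); last by rewrite -addn1.
rewrite -shift_add => _; have [->|/IH[h1 h2]] := eqVneq (shift k%:Z p) 0.
  exact: walkable_small.
have e u : shift 1 u = u + (1,1,1) by case: u => [[]].
by rewrite e; split; [case: (walkable_cycle h1)|case: (walkable_cycle h2)].
Qed.

Definition pos_part d : vec3 := (Num.max d.1.1 0, Num.max d.1.2 0, Num.max d.2 0).

Lemma pos_part_id d : le3 0 d -> pos_part d = d.
Proof.
case: d => [[a b] c] /and3P[/= h1 h2 h3].
by rewrite /pos_part; congr (_, _, _); apply/max_idPl.
Qed.

Lemma pos_part_opp d : le3 0 d -> pos_part (- d) = 0.
Proof.
case: d => [[a b] c] /and3P[/= h1 h2 h3].
by rewrite /pos_part; congr (_, _, _); apply/max_idPr; rewrite oppr_le0.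
Qed.

(** Induction on the number of back-and-forth pairs, added as detours to a walk for [d], whose
    coordinates have one common sign. *)
Lemma walkable_parts d m : flat d -> le3 0 m -> (d, m) != 0 ->
  walkable (pos_part d + m) (pos_part (- d) + m).
Proof.
move=> fd; have [k hk] : exists k : nat, level m = k%:Z \/ level m < 0.
  by exists (absz (level m)); lia.
elim: k m hk => [|k IH] m hk hm.
  have -> : m = 0.
    case: m hk hm => [[a b] c] hk /and3P[/= h1 h2 h3]; rewrite /level /= in hk.
    by congr (_, _, _); move: hk h1 h2 h3; clear; lia.
  rewrite !addr0 xpair_eqE eqxx andbT => d0.
  have [hd|hd] : le3 0 d \/ le3 0 (- d).
    move: fd => /and3P[]; case: (d) => [[a b] c] /= f1 f2 f3.
    by have [h|h] := leP 0 (a + b + c); [left|right]; apply/and3P; split=> /=;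
      move: f1 f2 f3 h; clear; lia.
  - by rewrite (pos_part_id hd) (pos_part_opp hd); case: (walkable_flat fd hd d0).
  rewrite (pos_part_id hd) -[in pos_part d](opprK d) (pos_part_opp hd).
  by have [||| _] := @walkable_flat (- d); rewrite ?flatN ?oppr_eq0.
have [u hu um] : exists2 u, u \in units & le3 0 (m - u).
  have [h|[h|h]] : 0 < m.1.1 \/ 0 < m.1.2 \/ 0 < m.2.
  - by move: hk hm; rewrite /level /le3 /=; case: (m) => [[a b] c] /=; clear; lia.
  - by exists (1,0,0) => //; move: h hm; rewrite /le3 /=; case: (m) => [[a b] c] /=; clear; lia.
  - by exists (0,1,0) => //; move: h hm; rewrite /le3 /=; case: (m) => [[a b] c] /=; clear; lia.
  by exists (0,0,1) => //; move: h hm; rewrite /le3 /=; case: (m) => [[a b] c] /=; clear; lia.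
have [lu _ _] := unitsP hu.
have hk' : level (m - u) = k%:Z \/ level (m - u) < 0.
  have -> : level (m - u) = level m - level u by rewrite /level /=; ring.
  by rewrite lu; move: hk; clear; lia.
(* With zero direction and a single pair there is no shorter walk to extend, so the pair itself is
   the walk. *)
have [/eqP|] := eqVneq (d, m - u) 0; last first.
  by move=> h _; have := walkable_detour hu (IH _ hk' um h); rewrite -!addrA addNr addr0.
rewrite xpair_eqE subr_eq0 => /andP[/eqP-> /eqP->].
rewrite oppr0 (_ : pos_part 0 = 0) // add0r.
move: hu; rewrite !inE => /or3P[]/eqP->.
- by exists a0, a1, [:: a0].
- by exists a1, a2, [:: a1].
by exists a2, a0, [:: a2].
Qed.

Lemma profile_walk n r : (0 < n)%N -> good n r -> exists x p,
  [/\ is_walk x p, size p = n & to_profile (forth (arcs x p)) (back (arcs x p)) = r].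
Proof.
case: r => [d m] n0 gr; have /and5P[fd m1 m2 m3 /eqP hn] := gr.
have dm0 : (d, m) != 0.
  apply/eqP=> -[e1 e2]; move: hn; rewrite e1 e2 /level /load /= normr0; move: n0; clear; lia.
have [x [y [p [hw ef eb]]]] := walkable_parts fd (good_slack gr) dm0.
exists x, (y :: p); split=> //.
  have [_ _ _ hs] := walk_balance hw; rewrite ef eb in hs.
  move: hs hn m1 m2 m3; move: (size _) => q; clear.
  case: d m => [[a b] c] [[e f] g]; rewrite /level /load /pos_part /=.
  by clear; lia.
rewrite ef eb; move: m1 m2 m3; clear; case: d m => [[a b] c] [[e f] g].
rewrite /to_profile /pos_part /= => e0 f0 g0.
by congr (_, _, _, (_, _, _)); move: e0 f0 g0; clear=> /=; lia.
Qed.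

Lemma sum_arcs (x : 'I_3) p i j :
  (\sum_(l < size p) ((nth ord0 (x :: p) l == i) && (nth ord0 (x :: p) l.+1 == j)))%N
  = count_mem (i, j) (pairmap pair x p).
Proof.
elim: p x => [|y p IH] x; first by rewrite big_ord0.
by rewrite big_ord_recl /= -IH.
Qed.

Definition word_head T (w : Omega T) : 'I_3 := head ord0 (val w).
Definition word_tail T (w : Omega T) : seq 'I_3 := behead (val w).

Lemma size_word_tail T (w : Omega T) : size (word_tail w) = T.-1.
Proof. by rewrite size_behead size_tuple. Qed.

Lemma wordE T (w : Omega T) : (0 < T)%N -> word_head w :: word_tail w = val w.
Proof.
by rewrite /word_head /word_tail -{1}(size_tuple (val w)); case: (tval (val w)).
Qed.

Lemma transE T (w : Omega T) i j : (0 < T)%N ->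
  (trans w i j)%:Z = arcs (word_head w) (word_tail w) (i, j).
Proof.
by move=> T0; rewrite /trans /arcs -sum_arcs size_word_tail wordE.
Qed.

Lemma word_walk T (w : Omega T) : (0 < T)%N -> is_walk (word_head w) (word_tail w).
Proof.
move=> T0; apply/(pathP ord0) => i; rewrite size_word_tail => hi.
have := valP w => /forallP/(_ (Ordinal hi)); rewrite -(wordE w T0).
by [].
Qed.

Lemma walk_word T x p : size p = T.-1 -> (0 < T)%N -> is_walk x p ->
  exists w : Omega T, word_head w = x /\ word_tail w = p.
Proof.
move=> sp T0 hw; have st : size (x :: p) == T by rewrite /= sp prednK.
have h : noloop (Tuple st).
  apply/forallP=> l; move/(pathP ord0): hw; apply; rewrite sp; exact: ltn_ord.
by exists (exist _ (Tuple st) h).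
Qed.

End Words.

(** * From profiles to Markov moves *)

Section MarkovBasis.

Implicit Types (r : profile).

Definition word_arcs T (w : Omega T) := arcs (word_head w) (word_tail w).

Definition word_profile T (w : Omega T) : profile :=
  to_profile (forth (word_arcs w)) (back (word_arcs w)).

Lemma load_to_profile f b : load (to_profile f b) = f + b.
Proof.
case: f b => [[f1 f2] f3] [[b1 b2] b3]; rewrite /load /to_profile /=.
have E (x y : int) : `|x - y| + 2 * Num.min x y = x + y by clear; lia.
by rewrite !E.
Qed.

(** This is the entry of $A^T$ applied to the multiset [W], see [Aentry_count_vec]. *)
Definition arc_total T (W : seq (Omega T)) a : int := \sum_(w <- W) word_arcs w a.

Lemma sum_word_profile T (W : seq (Omega T)) :
  (\sum_(d <- map fst (map (@word_profile T) W)) d.1.1 = arc_total W (a0, a1) - arc_total W (a1, a0)) *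
  (\sum_(d <- map fst (map (@word_profile T) W)) d.1.2 = arc_total W (a1, a2) - arc_total W (a2, a1)) *
  (\sum_(d <- map fst (map (@word_profile T) W)) d.2 = arc_total W (a2, a0) - arc_total W (a0, a2)) *
  (\sum_(d <- map load (map (@word_profile T) W)) d.1.1 = arc_total W (a0, a1) + arc_total W (a1, a0)) *
  (\sum_(d <- map load (map (@word_profile T) W)) d.1.2 = arc_total W (a1, a2) + arc_total W (a2, a1)) *
  (\sum_(d <- map load (map (@word_profile T) W)) d.2 = arc_total W (a2, a0) + arc_total W (a0, a2)).
Proof.
have Eload w : load (@word_profile T w) = forth (word_arcs w) + back (word_arcs w).
  exact: load_to_profile.
rewrite !big_map /arc_total -!sumrB -!big_split /=.
by do 5?split => //; apply: eq_bigr => w _;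
  [move: (congr1 (fun v : vec3 => v.1.1) (Eload w)) |
   move: (congr1 (fun v : vec3 => v.1.2) (Eload w)) |
   move: (congr1 (fun v : vec3 => v.2) (Eload w))].
Qed.

(** Every word has $T-1$ transitions, so the transition totals determine the number of words. *)
Lemma arc_total_size T (W : seq (Omega T)) : (0 < T)%N ->
  (size W * T.-1)%:Z = level (forth (arc_total W)) + level (back (arc_total W)).
Proof.
move=> T0; elim: W => [|w W IH].
  by rewrite mul0n /level /= /arc_total !big_nil.
rewrite /= mulSn PoszD IH; have [_ _ _] := walk_balance (word_walk w T0).
rewrite size_word_tail => <-; rewrite /level /forth /back /= /arc_total !big_cons /word_arcs.
by ring.
Qed.

Lemma same_total_word_profile T (W W' : seq (Omega T)) : (1 < T)%N ->
  (forall i j, i != j -> arc_total W (i, j) = arc_total W' (i, j)) <->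
  same_total (map (@word_profile T) W) (map (@word_profile T) W').
Proof.
move=> T1; have T0 := ltnW T1; split=> [h|[[_ e1 e2 e3] [_ e4 e5 e6]] i j ij].
  have sz : size W = size W'.
    have := arc_total_size W T0; rewrite /level /forth /back /= !h // => e.
    have := arc_total_size W' T0; rewrite /level /forth /back /= -e => -[].
    by move/eqP; rewrite eqn_pmul2r => [/eqP//|]; case: (T) T1 => [|[]].
  by split; split; rewrite ?size_map // !sum_word_profile !h.
rewrite !sum_word_profile in e1 e2 e3 e4 e5 e6; move: e1 e2 e3 e4 e5 e6 ij.
by have [->|->|->] := I3P i; have [->|->|->] := I3P j => // e1 e2 e3 e4 e5 e6 _;
  move: e1 e2 e3 e4 e5 e6; move: (arc_total W) (arc_total W') => a b;
  move: (a (a0, a1)) (a (a1, a0)) (a (a1, a2)) (a (a2, a1)) (a (a2, a0)) (a (a0, a2));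
  move: (b (a0, a1)) (b (a1, a0)) (b (a1, a2)) (b (a2, a1)) (b (a2, a0)) (b (a0, a2));
  clear; lia.
Qed.

Lemma good_word_profile T (w : Omega T) : (0 < T)%N -> good T.-1 (word_profile w).
Proof.
by move=> T0; rewrite -(size_word_tail w); apply: good_walk; exact: word_walk.
Qed.

Lemma word_profile_surj T r : (1 < T)%N -> good T.-1 r -> exists w : Omega T, word_profile w = r.
Proof.
move=> T1 gr; have n0 : (0 < T.-1)%N by case: (T) T1 => [|[]].
have [x [p [hw sp <-]]] := profile_walk n0 gr.
have [w [hx hp]] := walk_word sp (ltnW T1) hw.
by exists w; rewrite /word_profile /word_arcs hx hp.
Qed.

Lemma word_profiles_surj T X : (1 < T)%N -> all (good T.-1) X ->
  exists W : seq (Omega T), map (@word_profile T) W = X.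
Proof.
move=> T1; elim: X => [|r X IH] /=; first by exists [::].
by case/andP=> /(word_profile_surj T1)[w <-] /IH[W <-]; exists (w :: W).
Qed.

Definition count_vec T (W : seq (Omega T)) : vec T := [ffun w => (count_mem w W)%:Z].

Lemma count_vec_cat T (W W' : seq (Omega T)) :
  count_vec (W ++ W') = count_vec W + count_vec W'.
Proof. by apply/ffunP=> w; rewrite !ffunE count_cat PoszD. Qed.

Lemma count_vec_perm T (W W' : seq (Omega T)) :
  perm_eq W W' -> count_vec W = count_vec W'.
Proof. by move=> /permP h; apply/ffunP=> w; rewrite !ffunE h. Qed.

Lemma count_vec_ge0 T (W : seq (Omega T)) : nonneg (count_vec W).
Proof. by move=> w; rewrite ffunE. Qed.

Lemma sum_count_vec T (W : seq (Omega T)) (f : Omega T -> int) :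
  \sum_w count_vec W w * f w = \sum_(w <- W) f w.
Proof.
elim: W => [|w W IH].
  by rewrite big_nil big1 // => w _; rewrite ffunE mul0r.
rewrite big_cons -IH [LHS](bigD1 w) //= [in RHS](bigD1 w) //= !ffunE /= eqxx.
rewrite PoszD mulrDl mul1r -addrA; congr (_ + (_ + _)).
by apply: eq_bigr => v hv; rewrite !ffunE /= eq_sym (negPf hv).
Qed.

Lemma Aentry_count_vec T (W : seq (Omega T)) i j : (0 < T)%N ->
  Aentry (count_vec W) i j = arc_total W (i, j).
Proof.
move=> T0; rewrite /Aentry sum_count_vec; apply: eq_bigr => w _; exact: transE.
Qed.

Lemma nonneg_count_vec T (x : vec T) : nonneg x -> exists W, x = count_vec W.
Proof.
move=> hx; exists (flatten [seq nseq (absz (x w)) w | w <- enum (Omega T : finType)]).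
apply/ffunP=> w; rewrite ffunE count_flatten -map_comp.
rewrite (eq_map (g := fun v => ((v == w) * absz (x v))%N)); last first.
  by move=> v /=; rewrite count_nseq.
rewrite sumnE big_map big_enum /= (bigD1 w) //= eqxx mul1n big1 ?addn0.
  by rewrite gez0_abs //; exact: hx.
by move=> v /negPf ->.
Qed.

Lemma Aentry_sub T (x y : vec T) i j : Aentry (x - y) i j = Aentry x i j - Aentry y i j.
Proof. by rewrite /Aentry -sumrB; apply: eq_bigr => w _; rewrite !ffunE mulrBl. Qed.

(** Sequences of length at most 6 over a finite type form a finite type, so the kernel moves of
    degree at most 6 can be enumerated. *)
Definition small_moves T : seq (vec T) :=
  [seq z <- [seq count_vec (u : seq (Omega T)) - count_vec (v : seq (Omega T)) |
               u : 6.-bseq (Omega T : finType) <- enum {: 6.-bseq (Omega T : finType)},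
               v : 6.-bseq (Omega T : finType) <- enum {: 6.-bseq (Omega T : finType)}] |
   [forall i, forall j, (i != j) ==> (Aentry z i j == 0)]].

Lemma small_moves_kernel T z : z \in small_moves T -> in_kernel z.
Proof.
rewrite mem_filter => /andP[/forallP h _] i j ij.
by have /forallP/(_ j)/implyP/(_ ij)/eqP := h i.
Qed.

Lemma sum_count_vec_bseq T (u : 6.-bseq (Omega T : finType)) :
  \sum_w count_vec (u : seq (Omega T)) w <= 6.
Proof.
have := sum_count_vec u (fun=> 1); rewrite (eq_bigr (count_vec u)); last by move=> w _; rewrite mulr1.
move=> ->; rewrite big_const_seq count_predT iter_addr_0.
by rewrite natz; exact: (size_bseq u).
Qed.

(** Cancellation between the two sides can only lower the degree. *)
Lemma small_moves_degree T z : z \in small_moves T -> move_degree_le z 6.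
Proof.
rewrite mem_filter => /andP[_ /allpairsPdep[u [v [_ _ ->]]]].
split; [apply: le_trans (sum_count_vec_bseq u)|apply: le_trans (sum_count_vec_bseq v)];
  apply: ler_sum => w _; rewrite !ffunE; clear; lia.
Qed.

Lemma small_movesP T (u v : seq (Omega T)) : (0 < T)%N -> (size u <= 6)%N -> (size v <= 6)%N ->
  (forall i j, i != j -> arc_total u (i, j) = arc_total v (i, j)) ->
  count_vec u - count_vec v \in small_moves T.
Proof.
move=> T0 su sv h; rewrite mem_filter; apply/andP; split.
  apply/forallP=> i; apply/forallP=> j; apply/implyP=> ij.
  by rewrite Aentry_sub !Aentry_count_vec // h // subrr.
by apply/allpairsPdep; exists (Bseq su), (Bseq sv); split; rewrite ?mem_enum.
Qed.

Lemma connected_trans T Z (y x z : vec T) :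
  connected Z x y -> connected Z y z -> connected Z x z.
Proof.
elim=> // {}x m {}y hm h0 _ IH hz; first exact: conn_add hm h0 (IH hz).
exact: conn_sub hm h0 (IH hz).
Qed.

Lemma connected_small T (u v W : seq (Omega T)) : (1 < T)%N -> (size u <= 6)%N ->
  same_total (map (@word_profile T) u) (map (@word_profile T) v) ->
  connected (small_moves T) (count_vec (u ++ W)) (count_vec (v ++ W)).
Proof.
move=> T1 su h; have sv : (size v <= 6)%N.
  by have [[e _ _ _] _] := h; rewrite !size_map in e; rewrite -e.
have hm := small_movesP (ltnW T1) sv su (fun i j ij => esym ((same_total_word_profile u v T1).2 h i j ij)).
have e : count_vec (u ++ W) + (count_vec v - count_vec u) = count_vec (v ++ W).
  by rewrite !count_vec_cat addrC addrA subrK.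
by apply: conn_add hm _ _; rewrite e; [exact: count_vec_ge0 | exact: conn_refl].
Qed.

(** Words with equal profiles have equal transition counts, so they are swapped one at a time by
    moves of degree at most 1. [C] collects the words already matched. *)
Lemma connected_perm_profile T (W W' C : seq (Omega T)) : (1 < T)%N ->
  perm_eq (map (@word_profile T) W) (map (@word_profile T) W') ->
  connected (small_moves T) (count_vec (W ++ C)) (count_vec (W' ++ C)).
Proof.
move=> T1; elim: W W' C => [|w W IH] W' C hp.
  by have := perm_size hp; rewrite !size_map => /esym/size0nil->; exact: conn_refl.
have /mapP[w' w'W ew] : word_profile w \in map (@word_profile T) W' by rewrite -(perm_mem hp) mem_head.
have pW' := perm_to_rem w'W.
have h : perm_eq (map (@word_profile T) W) (map (@word_profile T) (rem w' W')).
  by have := perm_trans hp (perm_map (@word_profile T) pW'); rewrite /= ew perm_cons.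
apply: connected_trans (@connected_small T [:: w] [:: w'] (W ++ C) T1 _ _) _ => //.
  by rewrite /= ew.
have := IH _ (w' :: C) h.
rewrite (count_vec_perm (permEl (perm_catCA W [:: w'] C))).
rewrite (count_vec_perm (permEl (perm_catCA (rem w' W') [:: w'] C))) /=.
rewrite -(cat_cons w' (rem w' W')) -(@count_vec_perm T (W' ++ C) (_ ++ C)) //.
by rewrite perm_cat2r.
Qed.

(** Each intermediate multiset of profiles is lifted to words arbitrarily; [connected_perm_profile]
    repairs the mismatch between lifts. *)
Lemma connected_linked T X Y : (1 < T)%N -> linked T.-1 X Y -> all (good T.-1) X ->
  forall W W' : seq (Omega T), map (@word_profile T) W = X -> map (@word_profile T) W' = Y ->
  connected (small_moves T) (count_vec W) (count_vec W').
Proof.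
move=> T1; elim=> [{}X {}Y h|u v R su gu gv h|{}Y {}X Z cXY h1 _ h2] gX W W' eW eW'.
- by have := @connected_perm_profile T W W' [::] T1; rewrite !cats0 eW eW'; apply.
- have [V eV] := word_profiles_surj T1 gv.
  rewrite -(cat_take_drop (size u) W).
  have eu : map (@word_profile T) (take (size u) W) = u by rewrite map_take eW take_size_cat.
  have eR : map (@word_profile T) (drop (size u) W) = R by rewrite map_drop eW drop_size_cat.
  apply: (@connected_trans T _ (count_vec (V ++ drop (size u) W))).
    apply: connected_small => //; first by rewrite -(size_map (@word_profile T)) eu.
    by rewrite eu eV.
  have := @connected_perm_profile T (V ++ drop (size u) W) W' [::] T1; rewrite !cats0; apply.
  by rewrite map_cat eV eR eW'.
have gY := linked_good cXY gX; have [V eV] := word_profiles_surj T1 gY.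
exact: connected_trans (h1 gX _ _ eW eV) (h2 gY _ _ eV eW').
Qed.

End MarkovBasis.

Theorem theorem4 (T : nat) (hT : (3 <= T)%N) :
  exists Z : seq (vec T),
    markov_basis Z /\ (forall z, z \in Z -> move_degree_le z 6).
Proof.
have T1 : (1 < T)%N by exact: ltnW.
exists (small_moves T); split; last exact: small_moves_degree.
split; first exact: small_moves_kernel.
move=> _ _ /nonneg_count_vec[W ->] /nonneg_count_vec[W' ->] hf.
have g V : all (good T.-1) (map (@word_profile T) V).
  by apply/allP=> _ /mapP[w _ ->]; exact: good_word_profile (ltnW T1).
apply: (connected_linked T1 _ (g W) erefl erefl).
(* The bound $T \ge 3$ gives at least two steps per word, which [borrow_unit] relies on. *)
apply: linked_fiber => //; first by case: (T) hT => [|[|[]]].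
apply: (same_total_word_profile W W' T1).1 => i j ij.
by rewrite -!Aentry_count_vec ?(ltnW T1) //; exact: hf.
Qed.
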